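(* Fix a computable ordinal $\alpha$ and computable structures $\mathcal A$ and $\mathcal B$ (in the same language) so that $\mathcal A \not \leq_{\alpha+1}\mathcal B$. Then there exists a $\Pi^{\mathrm{c}}_{2\alpha+1}$ sentence $\varphi$ so that $\mathcal A\models \varphi$ and $\mathcal B\models \neg\varphi$.
   Context: $2\alpha$ denotes the standard ordinal product $2\cdot\alpha$, so $2(\lambda+n)=\lambda+2n$ for $\lambda$ a limit or $0$ and $n\in\omega$. Infinitary formulas ($L_{\omega_1\omega}$): $\Sigma^{\mathrm{in}}_0=\Pi^{\mathrm{in}}_0$ are finitary quantifier-free; for $\beta\geq1$, $\Sigma^{\mathrm{in}}_\beta$ formulas are countable disjunctions $\bigvee_i\exists\bar u_i\,\psi_i$ with each $\psi_i\in\Pi^{\mathrm{in}}_{\beta_i}$, $\beta_i<\beta$, and $\Pi^{\mathrm{in}}_\beta$ formulas are countable conjunctions $\bigwedge_i\forall\bar u_i\,\psi_i$ with each $\psi_i\in\Sigma^{\mathrm{in}}_{\beta_i}$, $\beta_i<\beta$. $\Pi^{\mathrm c}_\beta$ denotes the $\Pi^{\mathrm{in}}_\beta$ formulas in which all infinite conjunctions and disjunctions are (hereditarily) over c.e. sets of indices. Back-and-forth relations: $(\mathcal A,\bar a)\leq_0(\mathcal B,\bar b)$ if $\bar a,\bar b$ satisfy the same atomic formulas (if the language is infinite: agree on the first $|\bar a|$ atomic formulas). For $\beta\geq1$, $(\mathcal A,\bar a)\leq_\beta(\mathcal B,\bar b)$ if for every $\bar d$ in $\mathcal B$ and every $\delta<\beta$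 there is $\bar c$ in $\mathcal A$ with $(\mathcal B,\bar b\bar d)\leq_\delta(\mathcal A,\bar a\bar c)$. $\mathcal A\leq_\beta\mathcal B$ is the case of empty tuples.
   Formalization: For a finite language with function symbols of positive arity, ≤_0 means agreement on the first |a| atomic formulas (as for infinite languages), not on all; otherwise α=0 fails: A = infinitely many f-cycles of each length, B = A plus an infinite f-chain. *)

(* Defs.v *)
From Stdlib Require Cantor.
From Stdlib Require Import Relation_Operators Lexicographic_Product.
From mathcomp Require Import all_boot.

Set Implicit Arguments.
Unset Strict Implicit.
Unset Printing Implicit Defensive.

(** * Computability *)

Definition pairn (x y : nat) : nat := Cantor.to_nat (x, y).

Fixpoint code_seq (s : seq nat) : nat :=
  if s is x :: s' then (pairn x (code_seq s')).+1 else 0.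

(* Programs for the unary partial recursive functions; functions of several
   arguments go through the Cantor pairing.  The identity is
   [PPair PLeft PRight]. *)
Inductive prog : Type :=
| PZero | PSucc | PLeft | PRight
| PPair of prog & prog
| PComp of prog & prog
| PRec of prog & prog
| PMin of prog.

Inductive eval : prog -> nat -> nat -> Prop :=
| eval_zero x : eval PZero x 0
| eval_succ x : eval PSucc x x.+1
| eval_left x y : eval PLeft (pairn x y) x
| eval_right x y : eval PRight (pairn x y) y
| eval_pair p q x y z : eval p x y -> eval q x z -> eval (PPair p q) x (pairn y z)
| eval_comp p q x y z : eval q x y -> eval p y z -> eval (PComp p q) x z
| eval_rec0 p q x y : eval p x y -> eval (PRec p q) (pairn x 0) y
| eval_recS p q x n y z :
    eval (PRec p q) (pairn x n) y -> eval q (pairn x (pairn n y)) z ->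
    eval (PRec p q) (pairn x n.+1) z
| eval_min p x m :
    eval p (pairn x m) 0 ->
    (forall k, k < m -> exists y, eval p (pairn x k) y.+1) ->
    eval (PMin p) x m.

Fixpoint gn_prog (p : prog) : nat :=
  match p with
  | PZero => pairn 0 0
  | PSucc => pairn 1 0
  | PLeft => pairn 2 0
  | PRight => pairn 3 0
  | PPair p q => pairn 4 (pairn (gn_prog p) (gn_prog q))
  | PComp p q => pairn 5 (pairn (gn_prog p) (gn_prog q))
  | PRec p q => pairn 6 (pairn (gn_prog p) (gn_prog q))
  | PMin p => pairn 7 (gn_prog p)
  end.

Definition computable (f : nat -> nat) : Prop :=
  exists p, forall x, eval p x (f x).

Definition computable_set (S : nat -> Prop) : Prop :=
  exists2 f, computable f & forall n, S n <-> f n = 1.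

(* The c.e. set enumerated by p, i.e. the range of the partial function. *)
Definition ce_set (p : prog) (y : nat) : Prop := exists x, eval p x y.

(** * Ordinals *)

(* Ordinals are represented by well-orders; everything below depends only on
   the order type. *)
Record wellorder : Type := WellOrder {
  wo_sort :> Type;
  wo_lt : wo_sort -> wo_sort -> Prop;
  wo_wf : well_founded wo_lt;
  wo_trans : forall x y z, wo_lt x y -> wo_lt y z -> wo_lt x z;
  wo_total : forall x y, [\/ wo_lt x y, x = y | wo_lt y x]
}.

Definition is_zero (b : wellorder) : Prop := b -> False.

(* b is isomorphic to the proper initial segment of c below m. *)
Definition olt (b c : wellorder) : Prop :=
  exists (f : b -> c) (m : c),
    (forall x y, wo_lt x y <-> wo_lt (f x) (f y)) /\
    (forall z, wo_lt z m <-> exists x, f x = z).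

Section Succ.
Variable a : wellorder.

Definition succ_lt (x y : option a) : Prop :=
  match x, y with
  | Some x, Some y => wo_lt x y
  | Some _, None => True
  | None, _ => False
  end.

Lemma succ_wf : well_founded succ_lt.
Proof.
have accS x : Acc succ_lt (Some x).
  elim: (wo_wf x) => {}x _ IH; constructor; case=> [y h|[]]; exact: IH h.
case=> [x|]; first exact: accS.
constructor; case=> [y _|[]]; exact: accS.
Qed.

Lemma succ_trans x y z : succ_lt x y -> succ_lt y z -> succ_lt x z.
Proof. by case: x y z => [x|] [y|] [z|] //=; apply: wo_trans. Qed.

Lemma succ_total x y : [\/ succ_lt x y, x = y | succ_lt y x].
Proof.
case: x y => [x|] [y|] /=; [|by constructor 1|by constructor 3|by constructor 2].
case: (wo_total x y) => [?|->|?]; [by constructor 1|by constructor 2|by constructor 3].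
Qed.

Definition osucc : wellorder := WellOrder succ_wf succ_trans succ_total.
End Succ.

Section Double.
Variable a : wellorder.

Definition bool_lt (b c : bool) : Prop := ~~ b && c.

Definition double_lt : a * bool -> a * bool -> Prop :=
  slexprod a bool (@wo_lt a) bool_lt.

Lemma double_wf : well_founded double_lt.
Proof.
apply: wf_slexprod; first exact: wo_wf.
have acc0 : Acc bool_lt false by constructor; case=> [] h; discriminate h.
case; last exact: acc0.
constructor; case=> h; [discriminate h|exact: acc0].
Qed.

Lemma double_trans x y z : double_lt x y -> double_lt y z -> double_lt x z.
Proof.
case=> [x1 x2 b1 b2 lt12|x1 b1 b2 lt12]; move E: (_, b2) => p hyz;
  case: hyz E => [y1 y2 c1 c2 lt'|y1 c1 c2 lt'] [? ?]; subst.
- by apply: left_slex; apply: wo_trans lt12 lt'.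
- exact: left_slex.
- exact: left_slex.
- by apply: right_slex; move: lt12 lt'; case: (b1) (c1) (c2) => [] [] [].
Qed.

Lemma double_total x y : [\/ double_lt x y, x = y | double_lt y x].
Proof.
case: x y => [x b] [y c].
case: (wo_total x y) => [lt|->|lt].
- by constructor 1; apply: left_slex.
- case: b c => [] []; [by constructor 2|constructor 3|constructor 1|by constructor 2];
    exact: right_slex.
- by constructor 3; apply: left_slex.
Qed.

(* The ordinal product 2 * a, that is, a copies of 2: every element of a is
   replaced by two consecutive ones, so that 2 * (l + n) = l + 2n. *)
Definition odouble : wellorder := WellOrder double_wf double_trans double_total.
End Double.

(* The order type of a computable well-order of a computable set of naturals. *)
Definition computable_ordinal (a : wellorder) : Prop :=
  exists num : a -> nat,
    [/\ injective num,
        computable_set (fun n => exists x, num x = n)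
      & computable_set (fun n => exists x y, wo_lt x y /\ n = pairn (num x) (num y))].

(** * Languages and structures *)

(* At most one relation symbol and one function symbol per natural number;
   [rel_ar k = Some n] when there is a k-th relation symbol, of arity n.
   Constants are function symbols of arity 0. *)
Record language : Type := Language {
  rel_ar : nat -> option nat;
  fun_ar : nat -> option nat
}.

Definition code_opt (o : option nat) : nat := if o is Some n then n.+1 else 0.

Definition computable_language (L : language) : Prop :=
  computable (fun k => code_opt (rel_ar L k)) /\
  computable (fun k => code_opt (fun_ar L k)).

Definition rsym (L : language) : Type := {k : nat | isSome (rel_ar L k)}.
Definition fsym (L : language) : Type := {k : nat | isSome (fun_ar L k)}.
Definition rarity L (r : rsym L) : nat := odflt 0 (rel_ar L (val r)).
Definition farity L (f : fsym L) : nat := odflt 0 (fun_ar L (val f)).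

Inductive term (L : language) : Type :=
| Var of nat
| App (f : fsym L) of ('I_(farity f) -> term L).
Arguments Var {L}.

Inductive atomic (L : language) : Type :=
| Eq of term L & term L
| Rel (r : rsym L) of ('I_(rarity r) -> term L).

Inductive qf (L : language) : Type :=
| QTrue
| QAtom of atomic L
| QNot of qf L
| QAnd of qf L & qf L
| QOr of qf L & qf L.
Arguments QTrue {L}.

Fixpoint term_var L (t : term L) (j : nat) : Prop :=
  match t with
  | Var i => i = j
  | App f ts => exists i, term_var (ts i) j
  end.

Definition atomic_var L (p : atomic L) (j : nat) : Prop :=
  match p with
  | Eq s t => term_var s j \/ term_var t j
  | Rel r ts => exists i, term_var (ts i) j
  end.

Fixpoint qf_var L (q : qf L) (j : nat) : Prop :=
  match q with
  | QTrue => False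
  | QAtom p => atomic_var p j
  | QNot q => qf_var q j
  | QAnd q1 q2 | QOr q1 q2 => qf_var q1 j \/ qf_var q2 j
  end.

Fixpoint gn_term L (t : term L) : nat :=
  match t with
  | Var i => pairn 0 i
  | App f ts =>
      pairn 1 (pairn (val f) (code_seq [seq gn_term (ts i) | i <- enum 'I_(farity f)]))
  end.

Definition gn_atomic L (p : atomic L) : nat :=
  match p with
  | Eq s t => pairn 0 (pairn (gn_term s) (gn_term t))
  | Rel r ts =>
      pairn 1 (pairn (val r) (code_seq [seq gn_term (ts i) | i <- enum 'I_(rarity r)]))
  end.

Fixpoint gn_qf L (q : qf L) : nat :=
  match q with
  | QTrue => pairn 0 0
  | QAtom p => pairn 1 (gn_atomic p)
  | QNot q => pairn 2 (gn_qf q)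
  | QAnd q1 q2 => pairn 3 (pairn (gn_qf q1) (gn_qf q2))
  | QOr q1 q2 => pairn 4 (pairn (gn_qf q1) (gn_qf q2))
  end.

(* Structures whose universe is a nonempty set of natural numbers; [point]
   also serves as the default value of [nth]. *)
Record structure (L : language) : Type := Structure {
  dom : pred nat;
  point : {x : nat | dom x};
  rel_int : forall r : rsym L, ('I_(rarity r) -> {x : nat | dom x}) -> Prop;
  fun_int : forall f : fsym L, ('I_(farity f) -> {x : nat | dom x}) -> {x : nat | dom x}
}.

Definition carrier L (A : structure L) : Type := {x : nat | dom A x}.
Coercion carrier : structure >-> Sortclass.

Fixpoint term_val L (A : structure L) (v : nat -> A) (t : term L) : A :=
  match t with
  | Var i => v i
  | App f ts => @fun_int L A f (fun i => term_val v (ts i))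
  end.

Definition atomic_sat L (A : structure L) (v : nat -> A) (p : atomic L) : Prop :=
  match p with
  | Eq s t => term_val v s = term_val v t
  | Rel r ts => @rel_int L A r (fun i => term_val v (ts i))
  end.

Fixpoint qf_sat L (A : structure L) (v : nat -> A) (q : qf L) : Prop :=
  match q with
  | QTrue => True
  | QAtom p => atomic_sat v p
  | QNot q => ~ qf_sat v q
  | QAnd q1 q2 => qf_sat v q1 /\ qf_sat v q2
  | QOr q1 q2 => qf_sat v q1 \/ qf_sat v q2
  end.

Definition tuple_env L (A : structure L) (a : seq A) : nat -> A :=
  nth (point A : A) a.

Definition atomic_diagram L (A : structure L) (n : nat) : Prop :=
  exists (p : atomic L) (a : seq A),
    [/\ n = pairn (gn_atomic p) (code_seq [seq val x | x <- a]),
        forall j, atomic_var p j -> j < size a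
      & atomic_sat (tuple_env a) p].

Definition computable_structure L (A : structure L) : Prop :=
  computable_set (dom A) /\ computable_set (atomic_diagram A).

(** * Back-and-forth relations *)

(* An effective listing (repetitions allowed) of all atomic formulas, in which
   only the variables x_0, .., x_i may occur in the i-th one.  Thus the first
   n atomic formulas concern only the entries of an n-tuple. *)
Record atomic_listing (L : language) : Type := AtomicListing {
  list_atomic :> nat -> atomic L;
  list_effective : computable (fun i => gn_atomic (list_atomic i));
  list_all : forall p, exists i, list_atomic i = p;
  list_var : forall i j, atomic_var (list_atomic i) j -> j <= i
}.

(* Finite languages are meant to be those with finitely many atomic formulas in
   finitely many variables, so function symbols of positive arity are excluded. *)
Definition finite_language (L : language) : Prop :=
  (exists N, forall k, isSome (rel_ar L k) || isSome (fun_ar L k) -> k < N) /\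
  (forall f : fsym L, farity f = 0).

Definition bf_zero L (at_ : atomic_listing L) (A : structure L) (a : seq A)
    (B : structure L) (b : seq B) : Prop :=
  (finite_language L ->
     forall p : atomic L, (forall j, atomic_var p j -> j < size a) ->
       (atomic_sat (tuple_env a) p <-> atomic_sat (tuple_env b) p)) /\
  (~ finite_language L ->
     forall i, i < size a ->
       (atomic_sat (tuple_env a) (at_ i) <-> atomic_sat (tuple_env b) (at_ i))).

(* [bf at_ b A x B y] is (A, x) <=_b (B, y).  As the recursive occurrence is at
   a smaller ordinal, the inductive definition is the recursive one. *)
Inductive bf L (at_ : atomic_listing L) (b : wellorder) (A : structure L) (x : seq A)
    (B : structure L) (y : seq B) : Prop :=
| bf_base : is_zero b -> bf_zero at_ x y -> bf at_ b x y
| bf_step : ~ is_zero b ->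
    (forall (d : seq B) (g : wellorder), olt g b ->
       exists c : seq A, size c = size d /\ bf at_ g (y ++ d) (x ++ c)) ->
    bf at_ b x y.

Definition bf_le L (at_ : atomic_listing L) (b : wellorder) (A B : structure L) : Prop :=
  bf at_ b ([::] : seq A) ([::] : seq B).

(** * Infinitary formulas *)

(* [Disj P u psi] is the disjunction over the i in P of (exists u_i, psi_i) and
   [Conj P u psi] the conjunction over the i in P of (forall u_i, psi_i), where
   u_i is a finite list of variables. *)
Inductive form (L : language) : Type :=
| Qf of qf L
| Disj of (nat -> Prop) & (nat -> seq nat) & (nat -> form L)
| Conj of (nat -> Prop) & (nat -> seq nat) & (nat -> form L).

Fixpoint sat L (A : structure L) (v : nat -> A) (phi : form L) : Prop :=
  match phi with
  | Qf q => qf_sat v q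
  | Disj P u psi =>
      exists2 i, P i &
        exists w : nat -> A, (forall j, j \notin u i -> w j = v j) /\ sat w (psi i)
  | Conj P u psi =>
      forall i, P i ->
        forall w : nat -> A, (forall j, j \notin u i -> w j = v j) -> sat w (psi i)
  end.

Fixpoint free_var L (phi : form L) (j : nat) : Prop :=
  match phi with
  | Qf q => qf_var q j
  | Disj P u psi | Conj P u psi =>
      exists i, [/\ P i, j \notin u i & free_var (psi i) j]
  end.

Definition sentence L (phi : form L) : Prop := forall j, ~ free_var phi j.

Definition models L (A : structure L) (phi : form L) : Prop :=
  forall v : nat -> A, sat v phi.

Definition models_not L (A : structure L) (phi : form L) : Prop :=
  forall v : nat -> A, ~ sat v phi.

Inductive Sigma_in L : wellorder -> form L -> Prop :=
| Sigma_in0 b q : is_zero b -> Sigma_in b (Qf q)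
| Sigma_inS b P u psi : ~ is_zero b ->
    (forall i, P i -> exists g, olt g b /\ Pi_in g (psi i)) ->
    Sigma_in b (Disj P u psi)
with Pi_in L : wellorder -> form L -> Prop :=
| Pi_in0 b q : is_zero b -> Pi_in b (Qf q)
| Pi_inS b P u psi : ~ is_zero b ->
    (forall i, P i -> exists g, olt g b /\ Sigma_in g (psi i)) ->
    Pi_in b (Conj P u psi).

(* [has_index n phi]: all the infinite disjunctions and conjunctions in phi are
   hereditarily over c.e. sets of indices, and n is an index of phi.  An element
   m of such a c.e. set codes the list of variables u m together with an index
   of psi m. *)
Inductive has_index L : nat -> form L -> Prop :=
| index_qf q : has_index (pairn 0 (gn_qf q)) (Qf q)
| index_disj e u (k : nat -> nat) psi :
    (forall m, ce_set e m -> m = pairn (code_seq (u m)) (k m)) ->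
    (forall m, ce_set e m -> has_index (k m) (psi m)) ->
    has_index (pairn 1 (gn_prog e)) (Disj (ce_set e) u psi)
| index_conj e u (k : nat -> nat) psi :
    (forall m, ce_set e m -> m = pairn (code_seq (u m)) (k m)) ->
    (forall m, ce_set e m -> has_index (k m) (psi m)) ->
    has_index (pairn 2 (gn_prog e)) (Conj (ce_set e) u psi).

Definition Pi_c L (b : wellorder) (phi : form L) : Prop :=
  Pi_in b phi /\ exists n, has_index n phi.

(* Main.v *)
From Stdlib Require Cantor.
From Stdlib Require Import Classical ClassicalEpsilon FunctionalExtensionality.
From Stdlib Require Import Relation_Operators.
Require Import Defs.
From mathcomp Require Import all_boot zify.

(** Unfolding the definition, if A is not below B at level alpha + 1, then there
    are an ordinal m <= alpha and a tuple d in B such that (B, d) <=_m (A, c)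
    fails for every c in A.  The separating sentence says exactly this: for all
    tuples y, not (B, d) <=_m (-, y).  It fails in B because d itself is a
    counterexample, the relation being reflexive ([bf_seg_refl]).

    It remains to express not (B, x) <=_m (-, y) by a formula of complexity 2m in
    y, for a fixed tuple x of B.  Unfolding the relation once, its failure says
    that there are h < m and new elements z such that for all x' in B the relation
    (-, y z) <=_h (B, x x') fails.  The failure of the opposite relation
    (-, y) <=_m (B, x) says that there are h < m and x' in B such that for all z
    the relation (B, x x') <=_h (-, y z) fails.  In both cases one step down
    from m to h costs an infinitary disjunction followed by an infinitary
    conjunction, and since 2h + 1 < 2m ([olt_osucc_double]) the two families of
    formulas, defined by simultaneous recursion, are Sigma of level 2m.  At level
    zero both relations compare finitely many atomic formulas, so their failure
    is quantifier-free ([differ_formula]).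

    These formulas have c.e. connectives.  The system is described by computable
    rules that send the code of a formula (direction, ordinal, tuple) to the codes
    of its immediate subformulas, using the computability of alpha and of the
    diagram of B.  Turning codes into indices is circular, because a program that
    enumerates subformulas outputs the numbers of similar programs; Kleene's
    recursion theorem ([recursion_theorem], [index_scheme]) takes care of this.
    Formulas with these indices are then built, and their meaning and complexity
    computed, by well-founded induction on the ordinal ([bf_indices]). *)

Set Implicit Arguments.
Unset Strict Implicit.
Unset Printing Implicit Defensive.

(** * Pairing and codes of lists *)

Definition lft (n : nat) : nat := (Cantor.of_nat n).1.
Definition rgt (n : nat) : nat := (Cantor.of_nat n).2.

Lemma lft_pair x y : lft (pairn x y) = x.
Proof. by rewrite /lft /pairn Cantor.cancel_of_to. Qed.

Lemma rgt_pair x y : rgt (pairn x y) = y.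
Proof. by rewrite /rgt /pairn Cantor.cancel_of_to. Qed.

Definition pairE := (lft_pair, rgt_pair).

Lemma pairn_eta n : pairn (lft n) (rgt n) = n.
Proof.
by rewrite /pairn /lft /rgt -[RHS]Cantor.cancel_to_of; case: (Cantor.of_nat n).
Qed.

Lemma pairn_inj x y x' y' : pairn x y = pairn x' y' -> x = x' /\ y = y'.
Proof. by move=> /Cantor.to_nat_inj [-> ->]. Qed.

Lemma rgt_le n : rgt n <= n.
Proof.
rewrite -{2}(pairn_eta n) /pairn.
by have := Cantor.to_nat_non_decreasing (lft n) (rgt n); lia.
Qed.

Lemma code_seq_inj : injective code_seq.
Proof.
elim=> [|x s IH] [|y t] //= [] /pairn_inj [-> e]; by rewrite (IH _ e).
Qed.

Fixpoint dec_upto (k n : nat) : seq nat :=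
  if k is k'.+1 then
    if n is m.+1 then lft m :: dec_upto k' (rgt m) else [::]
  else [::].

(** Inverse to [code_seq] on all natural numbers, so that a program may read any
    input as a list. *)
Definition dec (n : nat) : seq nat := dec_upto n n.

Lemma decK n : code_seq (dec n) = n.
Proof.
rewrite /dec; suff: forall k n, n <= k -> code_seq (dec_upto k n) = n by apply.
elim=> [|k IH] [|m] //= le_mk.
by rewrite IH ?pairn_eta // (leq_trans (rgt_le m)).
Qed.

Lemma code_seqK s : dec (code_seq s) = s.
Proof. by apply: code_seq_inj; rewrite decK. Qed.

Lemma size_code_seq s : size s <= code_seq s.
Proof.
elim: s => //= x s IH; rewrite ltnS (leq_trans IH) //.
by rewrite -{1}(rgt_pair x (code_seq s)) rgt_le.
Qed.

(** * Programs *)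

Lemma eval_inv p x y : eval p x y ->
  match p with
  | PZero => y = 0
  | PSucc => y = x.+1
  | PLeft => y = lft x
  | PRight => y = rgt x
  | PPair p q => exists y1 y2, [/\ eval p x y1, eval q x y2 & y = pairn y1 y2]
  | PComp p q => exists2 z, eval q x z & eval p z y
  | PRec p q =>
      match rgt x with
      | 0 => eval p (lft x) y
      | n.+1 => exists2 z, eval (PRec p q) (pairn (lft x) n) z
                         & eval q (pairn (lft x) (pairn n z)) y
      end
  | PMin p => eval p (pairn x y) 0 /\
      forall k, k < y -> exists z, eval p (pairn x k) z.+1
  end.
Proof.
case=> {p x y} //=.
- by move=> x y; rewrite lft_pair.
- by move=> x y; rewrite rgt_pair.
- by move=> p q x y z ? ?; exists y, z.
- by move=> p q x y z ? ?; exists y.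
- by move=> p q x y ?; rewrite !pairE.
- by move=> p q x n y z ? ?; rewrite !pairE; exists y.
Qed.

(** By induction on the program rather than on the evaluation: the evaluations
    at the smaller arguments of a search [PMin] are hidden under an existential
    quantifier, where induction on the evaluation would not reach them. *)
Lemma eval_functional p x y z : eval p x y -> eval p x z -> y = z.
Proof.
elim: p x y z => [||||p IHp q IHq|p IHp q IHq|p IHp q IHq|p IHp] x y z.
- by move=> /eval_inv -> /eval_inv ->.
- by move=> /eval_inv -> /eval_inv ->.
- by move=> /eval_inv -> /eval_inv ->.
- by move=> /eval_inv -> /eval_inv ->.
- move=> /eval_inv [y1 [y2 [e1 e2 ->]]] /eval_inv [z1 [z2 [f1 f2 ->]]].
  by rewrite (IHp _ _ _ e1 f1) (IHq _ _ _ e2 f2).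
- move=> /eval_inv [y1 e1 e2] /eval_inv [z1 f1 f2].
  by move: f2; rewrite -(IHq _ _ _ e1 f1); apply: IHp.
- rewrite -(pairn_eta x); move: (lft x) (rgt x) => {}x n.
  elim: n y z => [|n IHn] y z /eval_inv + /eval_inv; rewrite !pairE.
    exact: IHp.
  move=> [y1 e1 e2] [z1 f1 f2]; move: f2; rewrite -(IHn _ _ e1 f1); exact: IHq.
- move=> /eval_inv [e0 e1] /eval_inv [f0 f1].
  case: (ltngtP y z) => // lt.
    by have [k ek] := f1 _ lt; have := IHp _ _ _ e0 ek.
  by have [k ek] := e1 _ lt; have := IHp _ _ _ f0 ek.
Qed.

Lemma gn_prog_inj : injective gn_prog.
Proof.
elim=> [||||p IHp q IHq|p IHp q IHq|p IHp q IHq|p IHp] [||||p' q'|p' q'|p' q'|p'] //=;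
  move=> /pairn_inj [] // _.
- by move=> /pairn_inj [/IHp -> /IHq ->].
- by move=> /pairn_inj [/IHp -> /IHq ->].
- by move=> /pairn_inj [/IHp -> /IHq ->].
- by move=> /IHp ->.
Qed.

(** * Closure properties of computable functions *)

Lemma eval_computable p f x y :
  (forall x, eval p x (f x)) -> eval p x y <-> y = f x.
Proof.
move=> pf; split=> [e|->]; last exact: pf.
exact: eval_functional e (pf x).
Qed.

Lemma comp_ext f g : f =1 g -> computable f -> computable g.
Proof. by move=> fg [p pf]; exists p => x; rewrite -fg. Qed.

Lemma comp_comp g f :
  computable g -> computable f -> computable (fun x => g (f x)).
Proof. by move=> [p pg] [q qf]; exists (PComp p q) => x; apply: eval_comp. Qed.

Lemma comp_lft f : computable f -> computable (fun x => lft (f x)).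
Proof.
apply: comp_comp; exists PLeft => x; rewrite -{1}(pairn_eta x); exact: eval_left.
Qed.

Lemma comp_rgt f : computable f -> computable (fun x => rgt (f x)).
Proof.
apply: comp_comp; exists PRight => x; rewrite -{1}(pairn_eta x); exact: eval_right.
Qed.

Lemma comp_pair f g :
  computable f -> computable g -> computable (fun x => pairn (f x) (g x)).
Proof. by move=> [p pf] [q qg]; exists (PPair p q) => x; apply: eval_pair. Qed.

Definition PId : prog := PPair PLeft PRight.

Lemma eval_id x y : eval PId x y <-> y = x.
Proof.
apply: (eval_computable (f := id)) => {}x.
rewrite /= -(pairn_eta x).
exact: (eval_pair (eval_left _ _) (eval_right _ _)).
Qed.

Lemma comp_id : computable (fun x => x).
Proof. by exists PId => x; apply/eval_id. Qed.

Lemma comp_succ f : computable f -> computable (fun x => (f x).+1).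
Proof. by apply: comp_comp; exists PSucc => x; apply: eval_succ. Qed.

Fixpoint PConst (c : nat) : prog :=
  if c is c'.+1 then PComp PSucc (PConst c') else PZero.

Lemma eval_const c x y : eval (PConst c) x y <-> y = c.
Proof.
apply: (eval_computable (f := fun=> c)) => {}x.
elim: c => [|c IH] /=; first exact: eval_zero.
exact: eval_comp IH (eval_succ _).
Qed.

Lemma comp_const c : computable (fun=> c).
Proof. by exists (PConst c) => x; apply/eval_const. Qed.

Fixpoint prim_rec (b : nat) (h : nat -> nat -> nat) (n : nat) : nat :=
  if n is k.+1 then h k (prim_rec b h k) else b.

(** In this lemma and the following ones, the first component of the argument
    of a step function is the current point [x], kept as a parameter. *)
Lemma comp_rec b h n :
  computable b -> computable n ->
  computable (fun z => h (lft z) (lft (rgt z)) (rgt (rgt z))) ->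
  computable (fun x => prim_rec (b x) (h x) (n x)).
Proof.
move=> cb cn [q qh].
have [p pb] := cb.
have cr : computable (fun z => prim_rec (b (lft z)) (h (lft z)) (rgt z)).
  exists (PRec p q) => z; rewrite -{1}(pairn_eta z).
  elim: (rgt z) => [|m IH]; first exact: eval_rec0.
  apply: (eval_recS IH).
  by have := qh (pairn (lft z) (pairn m (prim_rec (b (lft z)) (h (lft z)) m)));
    rewrite !pairE.
apply: (comp_ext (f := fun x => (fun z => prim_rec (b (lft z)) (h (lft z)) (rgt z))
                                  (pairn x (n x)))).
  by move=> x; rewrite !pairE.
by apply: (comp_comp cr); apply: comp_pair => //; apply: comp_id.
Qed.

Lemma comp_case n f g :
  computable n -> computable f -> computable (fun z => g (lft z) (rgt z)) ->
  computable (fun x => if n x is m.+1 then g x m else f x).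
Proof.
move=> cn cf cg.
apply: (comp_ext (f := fun x => prim_rec (f x) (fun k _ => g x k) (n x))).
  by move=> x; case: (n x).
apply: (comp_rec cf cn).
apply: (comp_ext (f := fun z => (fun z => g (lft z) (rgt z)) (pairn (lft z) (lft (rgt z))))).
  by move=> x; rewrite !pairE.
apply: (comp_comp cg).
by apply: comp_pair; repeat (apply: comp_lft || apply: comp_rgt); apply: comp_id.
Qed.

Lemma comp_if (t : nat -> bool) f g :
  computable (fun x => t x : nat) -> computable f -> computable g ->
  computable (fun x => if t x then f x else g x).
Proof.
move=> ct cf cg.
apply: (comp_ext (f := fun x => if (t x : nat) is m.+1 then f x else g x)).
  by move=> x; case: (t x).
apply: (comp_case (g := fun x _ => f x)) => //.
exact: (comp_comp cf (comp_lft comp_id)).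
Qed.

(** Two-argument functions are computable when they are so as functions of a
    pair; this restores the arguments. *)
Lemma comp2 h f g :
  computable (fun z => h (lft z) (rgt z)) -> computable f -> computable g ->
  computable (fun x => h (f x) (g x)).
Proof.
move=> ch cf cg.
apply: (comp_ext (f := fun x => (fun z => h (lft z) (rgt z)) (pairn (f x) (g x)))).
  by move=> x; rewrite !pairE.
exact: (comp_comp ch (comp_pair cf cg)).
Qed.

Ltac computable :=
  repeat first
    [ assumption | apply: comp_id | apply: comp_const | apply: comp_pair
    | apply: comp_lft | apply: comp_rgt | apply: comp_succ ].

Lemma comp_add f g :
  computable f -> computable g -> computable (fun x => f x + g x).
Proof.
move=> cf cg.
apply: (comp_ext (f := fun x => prim_rec (f x) (fun _ r => r.+1) (g x))).
  by move=> x; elim: (g x) => [|n IH] /=; rewrite ?addn0 ?addnS ?IH.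
by apply: comp_rec => //; computable.
Qed.

Lemma comp_sub f g :
  computable f -> computable g -> computable (fun x => f x - g x).
Proof.
move=> cf cg.
apply: (comp_ext (f := fun x => prim_rec (f x) (fun _ r => if r is m.+1 then m else 0) (g x))).
  by move=> x; elim: (g x) => [|n IH] /=; rewrite ?subn0 ?subnS ?IH //; case: (_ - _).
apply: comp_rec => //.
by apply: (comp_case (g := fun _ m => m)); computable.
Qed.

Lemma comp_eq f g :
  computable f -> computable g -> computable (fun x => (f x == g x) : nat).
Proof.
move=> cf cg.
apply: (comp_ext (f := fun x => if (f x - g x) + (g x - f x) is m.+1 then 0 else 1)).
  move=> x; case: eqP => [->|ne]; first by rewrite subnn.
  by case E: (_ + _) => //; lia.
apply: (comp_case (g := fun _ _ => 0)); computable.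
by apply: comp_add; apply: comp_sub.
Qed.

Lemma comp_and (s t : nat -> bool) :
  computable (fun x => s x : nat) -> computable (fun x => t x : nat) ->
  computable (fun x => (s x && t x) : nat).
Proof.
move=> cs ct; apply: (comp_ext (f := fun x => if s x then t x : nat else 0)).
  by move=> x; case: (s x).
by apply: comp_if => //; computable.
Qed.

(** * Computable functions with lists as values *)

Definition lcomp (F : nat -> seq nat) : Prop := computable (fun x => code_seq (F x)).

Lemma lcomp_ext F G : F =1 G -> lcomp F -> lcomp G.
Proof. by move=> FG; apply: comp_ext => x; rewrite FG. Qed.

Lemma lcomp_const s : lcomp (fun=> s).
Proof. exact: comp_const. Qed.

Lemma lcomp_comp F f : lcomp F -> computable f -> lcomp (fun x => F (f x)).
Proof. exact: comp_comp. Qed.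

Lemma lcomp_dec f : computable f -> lcomp (fun x => dec (f x)).
Proof. by apply: comp_ext => x; rewrite decK. Qed.

(** All other list operations reduce to this iteration, which decodes the list
    from the left while accumulating. *)
Lemma comp_foldl F b h :
  lcomp F -> computable b ->
  computable (fun z => h (lft z) (lft (rgt z)) (rgt (rgt z))) ->
  computable (fun x => foldl (h x) (b x) (F x)).
Proof.
move=> cF cb ch.
(* the state is the pair of the code of the unread part and the accumulator;
   the code of a list bounds its length *)
pose step x st := if lft st is m.+1 then pairn (rgt m) (h x (rgt st) (lft m)) else st.
apply: (comp_ext (f := fun x => rgt (prim_rec (pairn (code_seq (F x)) (b x))
                                      (fun _ => step x) (code_seq (F x))))).
  move=> x; suff it s k acc : k <= size s ->
      prim_rec (pairn (code_seq s) acc) (fun=> step x) k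
      = pairn (code_seq (drop k s)) (foldl (h x) acc (take k s)).
    have stop c acc : prim_rec (pairn (code_seq (F x)) acc) (fun=> step x) (size (F x) + c)
        = pairn 0 (foldl (h x) acc (F x)).
      elim: c => [|c IH]; first by rewrite addn0 it // drop_size take_size.
      by rewrite addnS /= IH /step lft_pair.
    by rewrite -[X in prim_rec _ _ X](subnKC (size_code_seq (F x))) stop rgt_pair.
  elim: k => [|k IH] lt_k; first by rewrite drop0 take0.
  rewrite /= IH 1?ltnW // /step lft_pair (drop_nth 0 lt_k) /= !pairE.
  by rewrite (take_nth 0 lt_k) foldl_rcons.
have cs : computable (fun z => step (lft z) (rgt (rgt z))).
  apply: (comp_case (n := fun z => lft (rgt (rgt z)))
            (g := fun z m => pairn (rgt m) (h (lft z) (rgt (rgt (rgt z))) (lft m)))).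
  - by computable.
  - by computable.
  apply: comp_pair; first by computable.
  apply: (comp_ext (f := fun z => (fun z => h (lft z) (lft (rgt z)) (rgt (rgt z)))
     (pairn (lft (lft z)) (pairn (rgt (rgt (rgt (lft z)))) (lft (rgt z)))))).
    by move=> z; rewrite !pairE.
  by apply: (comp_comp ch); computable.
by apply: comp_rgt; apply: (comp_rec (h := fun x _ => step x)); computable.
Qed.

Lemma lcomp_catrev F G : lcomp F -> lcomp G -> lcomp (fun x => catrev (F x) (G x)).
Proof.
move=> cF cG.
apply: (comp_ext (f := fun x => foldl (fun c a => (pairn a c).+1) (code_seq (G x)) (F x))).
  by move=> x; elim: (F x) (G x) => //= a s IH t; rewrite -IH.
by apply: (comp_foldl (h := fun _ c a => (pairn a c).+1)) => //; computable.
Qed.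

Lemma lcomp_rev F : lcomp F -> lcomp (fun x => rev (F x)).
Proof. by move=> cF; apply: lcomp_catrev => //; apply: lcomp_const. Qed.

Lemma lcomp_cat F G : lcomp F -> lcomp G -> lcomp (fun x => F x ++ G x).
Proof.
move=> cF cG; apply: (lcomp_ext (F := fun x => catrev (rev (F x)) (G x))).
  by move=> x; rewrite catrevE revK.
by apply: lcomp_catrev => //; apply: lcomp_rev.
Qed.

Lemma comp_foldr F b h :
  lcomp F -> computable b ->
  computable (fun z => h (lft z) (lft (rgt z)) (rgt (rgt z))) ->
  computable (fun x => foldr (h x) (b x) (F x)).
Proof.
move=> cF cb ch.
apply: (comp_ext (f := fun x => foldl (fun r a => h x a r) (b x) (rev (F x)))).
  by move=> x; rewrite foldl_rev.
apply: (comp_foldl (h := fun x r a => h x a r)) => //; first exact: lcomp_rev.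
apply: (comp_ext (f := fun z => (fun z => h (lft z) (lft (rgt z)) (rgt (rgt z)))
   (pairn (lft z) (pairn (rgt (rgt z)) (lft (rgt z)))))).
  by move=> z; rewrite !pairE.
by apply: (comp_comp ch); computable.
Qed.

Lemma lcomp_map F g :
  lcomp F -> computable (fun z => g (lft z) (rgt z)) ->
  lcomp (fun x => [seq g x a | a <- F x]).
Proof.
move=> cF cg.
apply: (comp_ext (f := fun x => foldr (fun a c => (pairn (g x a) c).+1) 0 (F x))).
  by move=> x; elim: (F x) => //= a s ->.
apply: (comp_foldr (h := fun x a c => (pairn (g x a) c).+1)) => //; computable.
by apply: (comp2 cg); computable.
Qed.

Lemma lcomp_allpairs F G f :
  lcomp F -> lcomp G -> computable (fun z => f (lft z) (rgt z)) ->
  lcomp (fun x => [seq f a c | a <- F x, c <- G x]).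
Proof.
move=> cF cG cf.
apply: (comp_ext (f := fun x =>
    foldr (fun a r => code_seq ([seq f a c | c <- G x] ++ dec r)) 0 (F x))).
  move=> x; elim: (F x) => [|a s IH] /=; first by [].
  by rewrite IH code_seqK.
apply: (comp_foldr (h := fun x a r => code_seq ([seq f a c | c <- G x] ++ dec r))) => //.
  by computable.
apply: (@lcomp_cat (fun z => [seq f (lft (rgt z)) c | c <- G (lft z)])); last first.
  by apply: lcomp_dec; computable.
apply: (lcomp_map (F := fun z => G (lft z)) (g := fun z c => f (lft (rgt z)) c)).
  by apply: lcomp_comp => //; computable.
by apply: (comp2 cf); computable.
Qed.

Lemma comp_size F : lcomp F -> computable (fun x => size (F x)).
Proof.
move=> cF; apply: (comp_ext (f := fun x => foldr (fun _ n => n.+1) 0 (F x))).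
  by move=> x; elim: (F x) => //= _ s ->.
by apply: (comp_foldr (h := fun _ _ n => n.+1)) => //; computable.
Qed.

Lemma comp_all (D : pred nat) F :
  computable (fun n => D n : nat) -> lcomp F ->
  computable (fun x => all D (F x) : nat).
Proof.
move=> cD cF.
apply: (comp_ext (f := fun x => foldr (fun a r => if D a then r else 0) 1 (F x))).
  by move=> x; elim: (F x) => //= a s ->; case: (D a).
apply: (comp_foldr (h := fun _ a r => if D a then r else 0)) => //; computable.
apply: (comp_if (t := fun z => D (lft (rgt z)))); computable.
by apply: (comp_comp cD); computable.
Qed.

Lemma lcomp_iota m n : computable m -> computable n -> lcomp (fun x => iota (m x) (n x)).
Proof.
move=> cm cn.
apply: (comp_ext (f := fun x =>
    prim_rec 0 (fun k c => code_seq (dec c ++ [:: m x + k])) (n x))).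
  move=> x; elim: (n x) => // k IH.
  by rewrite -[in RHS]addn1 iotaD /= IH code_seqK.
apply: (comp_rec (h := fun x k c => code_seq (dec c ++ [:: m x + k]))); computable.
apply: lcomp_cat; first by apply: lcomp_dec; computable.
rewrite /lcomp /=; computable; apply: comp_add; last by computable.
by apply: (comp_comp cm); computable.
Qed.

(** * Self-reference and indices of families of formulas *)

(** The unbounded search restricts a computable function to a computable set:
    it searches for a [k] with a property that does not mention [k]. *)
Lemma comp_guarded (t : nat -> bool) g :
  computable (fun x => t x : nat) -> computable g ->
  exists p, forall x y, eval p x y <-> t x /\ y = g x.
Proof.
move=> ct [pg eg].
have [pt et] : computable (fun z => if t (lft z) then 0 else 1).
  by apply: (comp_if (t := fun z => t (lft z))); computable;
     apply: (comp_comp ct); computable.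
have emin x y : eval (PMin pt) x y <-> t x /\ y = 0.
  split=> [/eval_inv [e0 elt]|[tx ->]].
    have := eval_functional e0 (et _); rewrite lft_pair; case: ifP => // tx _.
    split=> //; case: y e0 elt => // y _ /(_ 0 isT) [z ez].
    by have := eval_functional ez (et _); rewrite lft_pair tx.
  apply: eval_min => //.
  by have := et (pairn x 0); rewrite lft_pair tx.
exists (PComp pg (PComp PLeft (PPair PId (PMin pt)))) => x y; split.
  move=> /eval_inv [z /eval_inv [z1 /eval_inv [y1 [y2 []]]]].
  move=> /eval_id -> /emin [tx ->] -> /eval_inv; rewrite lft_pair => -> exy.
  by split=> //; apply: eval_functional exy (eg x).
move=> [tx ->]; apply: eval_comp (eg x).
apply: eval_comp (eval_left x 0).
by apply: eval_pair; [apply/eval_id | apply/emin].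
Qed.

Definition PSpec (p : prog) (c : nat) : prog := PComp p (PPair (PConst c) PId).

Lemma eval_spec p c x y : eval (PSpec p c) x y <-> eval p (pairn c x) y.
Proof.
split=> [/eval_inv [z /eval_inv [y1 [y2 []]]]|e].
  by move=> /eval_const -> /eval_id -> ->.
by apply: eval_comp e; apply: eval_pair; [apply/eval_const | apply/eval_id].
Qed.

(** The numerical counterpart of [PSpec]: indices of specialised programs are
    computed from the parameter, which is what makes them available inside the
    enumerations of subformulas. *)
Definition smn (n c : nat) : nat :=
  pairn 5 (pairn n (pairn 4 (pairn (gn_prog (PConst c)) (gn_prog PId)))).

Lemma gn_spec p c : gn_prog (PSpec p c) = smn (gn_prog p) c.
Proof. by []. Qed.

Lemma comp_smn f g :
  computable f -> computable g -> computable (fun x => smn (f x) (g x)).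
Proof.
move=> cf cg; rewrite /smn; computable.
apply: (comp_comp (g := fun c => gn_prog (PConst c))) => //.
apply: (comp_ext (f := fun c =>
    prim_rec (gn_prog PZero) (fun _ r => pairn 5 (pairn (gn_prog PSucc) r)) c)).
  by elim=> // c IH; rewrite [LHS]/= IH.
by apply: (comp_rec (h := fun _ _ r => pairn 5 (pairn (gn_prog PSucc) r))); computable.
Qed.

(** Kleene's recursion theorem.  The program [d] regards the first component of
    its argument as the number of a program, specialises that program at its own
    number, and hands the result to [q]; so [d] specialised at its own number
    hands its own number to [q]. *)
Lemma recursion_theorem q :
  exists p, forall x y, eval p x y <-> eval q (pairn (gn_prog p) x) y.
Proof.
have [r er] : computable (fun z => pairn (smn (lft z) (lft z)) (rgt z)).
  by apply: comp_pair; [apply: comp_smn|]; computable.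
pose d := PComp q r.
exists (PSpec d (gn_prog d)) => x y.
rewrite eval_spec gn_spec; have := er (pairn (gn_prog d) x); rewrite !pairE => e.
split=> [/eval_inv [z ez]|]; first by rewrite (eval_functional ez e).
exact: eval_comp.
Qed.

(** Indices for a system of formulas given by computable transition rules on
    states.  The formula of a state [s] is either a leaf, with a given
    quantifier-free code, or an infinitary disjunction or conjunction (according
    to [tag]) of the formulas of the states [nxt s x] for the [x] in a computable
    set [grd s], under the quantifiers over the variables coded by [vr s x].
    The index of a state has to mention the indices of its successors, and this
    circularity is resolved by the recursion theorem. *)
Lemma index_scheme (leaf : nat -> bool) (tag qfc : nat -> nat)
    (grd : nat -> nat -> bool) (nxt vr : nat -> nat -> nat) :
  computable (fun s => leaf s : nat) -> computable tag -> computable qfc ->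
  computable (fun z => grd (lft z) (rgt z) : nat) ->
  computable (fun z => nxt (lft z) (rgt z)) ->
  computable (fun z => vr (lft z) (rgt z)) ->
  exists (idx : nat -> nat) (e : nat -> prog),
    (forall s, idx s = if leaf s then pairn 0 (qfc s) else pairn (tag s) (gn_prog (e s))) /\
    (forall s m, ce_set (e s) m <-> exists2 x, grd s x & m = pairn (vr s x) (idx (nxt s x))).
Proof.
move=> cleaf ctag cqfc cgrd cnxt cvr.
pose ix n s := if leaf s then pairn 0 (qfc s) else pairn (tag s) (smn n s).
have cix : computable (fun z => ix (lft z) (rgt z)).
  apply: (comp_if (t := fun z => leaf (rgt z))); first by apply: (comp_comp cleaf); computable.
    by computable; apply: (comp_comp cqfc); computable.
  apply: comp_pair; first by apply: (comp_comp ctag); computable.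
  by apply: comp_smn; computable.
pose st z := lft (rgt z); pose inp z := rgt (rgt z).
have cst : computable st by rewrite /st; computable.
have cinp : computable inp by rewrite /inp; computable.
have [q eq] : exists q, forall z y, eval q z y <->
    grd (st z) (inp z) /\ y = pairn (vr (st z) (inp z)) (ix (lft z) (nxt (st z) (inp z))).
  apply: (comp_guarded (t := fun z => grd (st z) (inp z))
      (g := fun z => pairn (vr (st z) (inp z)) (ix (lft z) (nxt (st z) (inp z))))).
    exact: (comp2 (h := fun s x => grd s x : nat)).
  apply: comp_pair; first exact: (comp2 (h := vr)).
  by apply: (comp2 cix); [computable | apply: (comp2 (h := nxt))].
have [p ep] := recursion_theorem q.
exists (ix (gn_prog p)), (PSpec p); split=> [//|s m].
split=> [[x /eval_spec /ep /eq]|[x gx ->]].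
  by rewrite /st /inp !pairE => -[gx ->]; exists x.
by exists x; apply/eval_spec/ep/eq; rewrite /st /inp !pairE.
Qed.

(** * Goedel numbers determine formulas *)

Lemma code_map_inj (T : Type) n (f : T -> nat) (s t : 'I_n -> T) :
  (forall i y, f (s i) = f y -> s i = y) ->
  code_seq [seq f (s i) | i <- enum 'I_n] = code_seq [seq f (t i) | i <- enum 'I_n] -> s = t.
Proof.
move=> inj /code_seq_inj /eq_in_map e; apply: functional_extensionality => i.
by apply: inj; apply: e; rewrite mem_enum.
Qed.

Lemma gn_term_inj L : injective (@gn_term L).
Proof.
elim=> [i|f ts IH] [j|g us] //= /pairn_inj [] // _; first by move=> ->.
move=> /pairn_inj [/val_inj fg]; case: g / fg us => us /code_map_inj -> //.
Qed.

Lemma gn_atomic_inj L : injective (@gn_atomic L).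
Proof.
case=> [s t|r ts] [s' t'|r' ts'] //= /pairn_inj [] // _.
  by move=> /pairn_inj [/gn_term_inj -> /gn_term_inj ->].
move=> /pairn_inj [/val_inj rr]; case: r' / rr ts' => us /code_map_inj -> //.
by move=> i y; apply: gn_term_inj.
Qed.

Lemma gn_qf_inj L : injective (@gn_qf L).
Proof.
elim=> [|p|q IH|q1 IH1 q2 IH2|q1 IH1 q2 IH2] [|p'|q'|q1' q2'|q1' q2'] //=
  /pairn_inj [] // _.
- by move=> /gn_atomic_inj ->.
- by move=> /IH ->.
- by move=> /pairn_inj [/IH1 -> /IH2 ->].
- by move=> /pairn_inj [/IH1 -> /IH2 ->].
Qed.

Lemma has_index_inv L n (phi : form L) : has_index n phi ->
  match phi with
  | Qf q => n = pairn 0 (gn_qf q)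
  | Disj P u psi =>
      exists e k, [/\ n = pairn 1 (gn_prog e), P = ce_set e,
        forall m, ce_set e m -> m = pairn (code_seq (u m)) (k m)
        & forall m, ce_set e m -> has_index (k m) (psi m)]
  | Conj P u psi =>
      exists e k, [/\ n = pairn 2 (gn_prog e), P = ce_set e,
        forall m, ce_set e m -> m = pairn (code_seq (u m)) (k m)
        & forall m, ce_set e m -> has_index (k m) (psi m)]
  end.
Proof. by case=> {n phi} // e u k psi eu ek; exists e, k. Qed.

(** * What an index denotes *)

(** The index [n] denotes a formula whose complexity is as in [lev], with free
    variables below [k] and meaning [S].  Requiring this of all formulas with
    that index, rather than of one, matters in [denotes_disj]: different members
    of an enumeration may have equal codes, and the chosen subformula has to
    serve all of them. *)
Definition denotes L (n : nat) (lev : form L -> Prop) (k : nat)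
    (S : forall C : structure L, (nat -> C) -> Prop) : Prop :=
  (exists phi : form L, has_index n phi) /\
  (forall phi : form L, has_index n phi ->
     [/\ lev phi, forall j, free_var phi j -> j < k
       & forall (C : structure L) (v : nat -> C), sat v phi <-> S C v]).

Lemma denotes_ext L n lev k (S T : forall C : structure L, (nat -> C) -> Prop) :
  (forall (C : structure L) v, S C v <-> T C v) ->
  denotes n lev k S -> denotes n lev k T.
Proof.
move=> ST [ex all_]; split=> // phi /all_ [l f s]; split=> // C v.
by rewrite s ST.
Qed.

Lemma denotes_qf L b (q : qf L) k :
  is_zero b -> (forall j, qf_var q j -> j < k) ->
  denotes (pairn 0 (gn_qf q)) (Sigma_in b) k (fun C v => qf_sat v q).
Proof.
move=> b0 vars; split; first by exists (Qf q); apply: index_qf.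
case=> [q' /has_index_inv|? ? ? /has_index_inv [? [? []]]|? ? ? /has_index_inv [? [? []]]];
  move=> /pairn_inj [] // _ /gn_qf_inj <-.
by split=> //; apply: Sigma_in0.
Qed.

Lemma index_members L e (G : nat -> Prop) (u : nat -> seq nat) (i : nat -> nat) :
  (forall m, ce_set e m <-> exists2 x, G x & m = pairn (code_seq (u x)) (i x)) ->
  (forall x, G x -> exists phi : form L, has_index (i x) phi) ->
  exists psi : nat -> form L, forall m, ce_set e m -> has_index (rgt m) (psi m).
Proof.
move=> eE ex.
apply: (choice (fun m phi => ce_set e m -> has_index (rgt m) phi)) => m.
case: (classic (ce_set e m)) => [/eE [x /ex [phi hphi] ->]|n].
  by exists phi => _; rewrite rgt_pair.
by exists (Qf (@QTrue L)).
Qed.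

Lemma denotes_disj L b e (G : nat -> Prop) (u : nat -> seq nat) (i K : nat -> nat) k
    (S : nat -> forall C : structure L, (nat -> C) -> Prop) :
  ~ is_zero b ->
  (forall m, ce_set e m <-> exists2 x, G x & m = pairn (code_seq (u x)) (i x)) ->
  (forall x, G x -> exists g, olt g b /\ denotes (i x) (Pi_in g) (K x) (S x)) ->
  (forall x j, G x -> j < K x -> j \notin u x -> j < k) ->
  denotes (pairn 1 (gn_prog e)) (Sigma_in b) k
    (fun C v => exists x w, [/\ G x, forall j, j \notin u x -> w j = v j & S x C w]).
Proof.
move=> b0 eE den vars; split.
  have [|psi psiP] := @index_members L e G u i eE.
    by move=> x /den [g [_ []]].
  exists (Disj (ce_set e) (fun m => dec (lft m)) psi).
  by apply: (index_disj (k := rgt)) => // m _; rewrite decK pairn_eta.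
case=> [q /has_index_inv /pairn_inj [] //| |? ? ? /has_index_inv [? [? [/pairn_inj []]]] //].
move=> P u' psi /has_index_inv [e' [k' [/pairn_inj [_ /gn_prog_inj <-] -> um im]]] {e' P}.
have mem x : G x -> let m := pairn (code_seq (u x)) (i x) in
    [/\ ce_set e m, u' m = u x & has_index (i x) (psi m)].
  move=> Gx m; have em : ce_set e m by apply/eE; exists x.
  have [/code_seq_inj -> ek] := pairn_inj (um _ em).
  by split=> //; rewrite ek; apply: im.
split.
- apply: Sigma_inS => // _ /eE [x Gx ->]; have [em _ ix] := mem x Gx.
  by have [g [lt [_ /(_ _ ix) [lev _ _]]]] := den x Gx; exists g.
- move=> j [_ [/eE [x Gx ->]]]; have [em -> ix] := mem x Gx => ju fj.
  have [g [lt [_ /(_ _ ix) [_ fv _]]]] := den x Gx.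
  by apply: (vars x) => //; apply: fv.
- move=> C v; split=> [[_ /eE [x Gx ->] [w]]|[x [w [Gx wv Sw]]]];
    have [em uE ix] := mem x Gx;
    have [g [lt [_ /(_ _ ix) [_ _ sE]]]] := den x Gx.
    by rewrite uE => -[wv /sE Sw]; exists x, w.
  exists (pairn (code_seq (u x)) (i x)) => //; exists w; split; last exact/sE.
  by move=> j; rewrite uE; apply: wv.
Qed.

Lemma denotes_conj L b e (G : nat -> Prop) (u : nat -> seq nat) (i K : nat -> nat) k
    (S : nat -> forall C : structure L, (nat -> C) -> Prop) :
  ~ is_zero b ->
  (forall m, ce_set e m <-> exists2 x, G x & m = pairn (code_seq (u x)) (i x)) ->
  (forall x, G x -> exists g, olt g b /\ denotes (i x) (Sigma_in g) (K x) (S x)) ->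
  (forall x j, G x -> j < K x -> j \notin u x -> j < k) ->
  denotes (pairn 2 (gn_prog e)) (Pi_in b) k
    (fun C v => forall x w, G x -> (forall j, j \notin u x -> w j = v j) -> S x C w).
Proof.
move=> b0 eE den vars; split.
  have [|psi psiP] := @index_members L e G u i eE.
    by move=> x /den [g [_ []]].
  exists (Conj (ce_set e) (fun m => dec (lft m)) psi).
  by apply: (index_conj (k := rgt)) => // m _; rewrite decK pairn_eta.
case=> [q /has_index_inv /pairn_inj [] //|? ? ? /has_index_inv [? [? [/pairn_inj []]]] //|].
move=> P u' psi /has_index_inv [e' [k' [/pairn_inj [_ /gn_prog_inj <-] -> um im]]] {e' P}.
have mem x : G x -> let m := pairn (code_seq (u x)) (i x) in
    [/\ ce_set e m, u' m = u x & has_index (i x) (psi m)].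
  move=> Gx m; have em : ce_set e m by apply/eE; exists x.
  have [/code_seq_inj -> ek] := pairn_inj (um _ em).
  by split=> //; rewrite ek; apply: im.
split.
- apply: Pi_inS => // _ /eE [x Gx ->]; have [em _ ix] := mem x Gx.
  by have [g [lt [_ /(_ _ ix) [lev _ _]]]] := den x Gx; exists g.
- move=> j [_ [/eE [x Gx ->]]]; have [em -> ix] := mem x Gx => ju fj.
  have [g [lt [_ /(_ _ ix) [_ fv _]]]] := den x Gx.
  by apply: (vars x) => //; apply: fv.
- move=> C v; split=> [h x w Gx wv|h _ /eE [x Gx ->] w];
    have [em uE ix] := mem x Gx;
    have [g [lt [_ /(_ _ ix) [_ _ sE]]]] := den x Gx.
    by apply/sE; apply: h em _ _; rewrite uE.
  by rewrite uE => wv; apply/sE; apply: h.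
Qed.

(** * Initial segments and ordinal arithmetic *)

Lemma wo_irrefl (a : wellorder) (x : a) : ~ wo_lt x x.
Proof. by elim: (wo_wf x) => {}x _ IH lt; exact: (IH x). Qed.

Definition iso (a b : wellorder) : Prop :=
  exists f : a -> b, (forall x y, wo_lt x y <-> wo_lt (f x) (f y)) /\
                     (forall z, exists x, f x = z).

Lemma iso_sym a b : iso a b -> iso b a.
Proof.
move=> [f [mono /choice [g gK]]]; exists g; split=> [x y|x].
  by rewrite mono !gK.
exists (f x); case: (wo_total (g (f x)) x) => // lt; exfalso.
  by move/mono: lt; rewrite gK; apply: wo_irrefl.
by move/mono: lt; rewrite gK; apply: wo_irrefl.
Qed.

Lemma olt_iso a b c : olt a b -> iso b c -> olt a c.
Proof.
move=> [f [m [mono below]]] [g [gmono gsurj]]; exists (fun x => g (f x)), (g m).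
split=> [x y|z]; first by rewrite mono gmono.
split=> [|[x <-]]; last by apply/gmono/below; exists x.
have [y <-] := gsurj z; move=> /gmono /below [x <-]; by exists x.
Qed.

Lemma is_zero_iso a b : iso a b -> is_zero a -> is_zero b.
Proof. by move=> [f [_ surj]] a0 z; have [x _] := surj z; apply: a0 x. Qed.

(** The relation depends on the order type only, so that along a well-order it
    suffices to consider its initial segments. *)
Lemma bf_iso L (at_ : atomic_listing L) a b (C D : structure L) (x : seq C) (y : seq D) :
  iso a b -> bf at_ a x y -> bf at_ b x y.
Proof.
move=> ab [a0 h|a0 h]; first by apply: bf_base h; apply: is_zero_iso ab a0.
have ba := iso_sym ab.
apply: bf_step => [b0|d g gb]; first by apply: a0; apply: is_zero_iso ba b0.
by apply: h; apply: olt_iso gb ba.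
Qed.

Definition seg_lt (a : wellorder) (m : a) (x y : {x : a | wo_lt x m}) : Prop :=
  wo_lt (sval x) (sval y).

Lemma seg_wf (a : wellorder) (m : a) : well_founded (@seg_lt a m).
Proof.
move=> [x]; elim: (wo_wf x) => {}x _ IH lt; constructor=> -[y lty] /= yx.
exact: IH.
Qed.

Lemma seg_trans (a : wellorder) (m : a) (x y z : {x : a | wo_lt x m}) :
  seg_lt x y -> seg_lt y z -> seg_lt x z.
Proof. exact: wo_trans. Qed.

Lemma seg_ext (a : wellorder) (m : a) (x y : {x : a | wo_lt x m}) : sval x = sval y -> x = y.
Proof. by case: x y => [x p] [y q] /= e; subst y; rewrite (proof_irrelevance _ p q). Qed.

Lemma seg_total (a : wellorder) (m : a) (x y : {x : a | wo_lt x m}) :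
  [\/ seg_lt x y, x = y | seg_lt y x].
Proof.
case: (wo_total (sval x) (sval y)) => [?|/seg_ext|?];
  by [constructor 1|constructor 2|constructor 3].
Qed.

(** The initial segments of one well-order are concrete representatives of all
    the smaller ordinals. *)
Definition seg (a : wellorder) (m : a) : wellorder :=
  WellOrder (@seg_wf a m) (@seg_trans a m) (@seg_total a m).

Lemma is_zero_seg (a : wellorder) (m : a) : is_zero (seg m) <-> forall h : a, ~ wo_lt h m.
Proof. by split=> [z h lt|h [x]]; [apply: z (exist _ h lt) | apply: h]. Qed.

Lemma seg_olt (a : wellorder) (h m : a) : wo_lt h m -> olt (seg h) (seg m).
Proof.
move=> hm.
exists (fun x : seg h => exist _ (sval x) (wo_trans (svalP x) hm) : seg m), (exist _ h hm).
split=> [//|[z zm]]; split=> [zh|[[x xh] e]].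
  by exists (exist _ z zh); apply: seg_ext.
by change (wo_lt z h); case: e => <-.
Qed.

Lemma olt_iso_seg (g a : wellorder) : olt g a -> exists m : a, iso g (seg m).
Proof.
move=> [f [m [mono below]]]; exists m.
have fm x : wo_lt (f x) m by apply/below; exists x.
exists (fun x => exist _ (f x) (fm x) : seg m); split=> [x y|[z zm]]; first exact: mono.
have /below [x e] := zm; exists x; exact: seg_ext.
Qed.

Lemma olt_seg (g a : wellorder) (m : a) :
  olt g (seg m) -> exists2 h : a, wo_lt h m & iso g (seg h).
Proof.
move=> [f [[h hm] [mono below]]]; exists h => //.
have fh x : wo_lt (sval (f x)) h.
  by have [_] := below (f x); apply; exists x.
exists (fun x => exist _ (sval (f x)) (fh x) : seg h).
split=> [x y|[z zh]]; first exact: mono.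
have [/(_ zh) [x e] _] := below (exist _ z (wo_trans zh hm)).
by exists x; apply: seg_ext; rewrite /= e.
Qed.

Lemma double_ltE (a : wellorder) (x y : a) (b c : bool) :
  double_lt (x, b) (y, c) <-> wo_lt x y \/ x = y /\ ~~ b && c.
Proof.
split=> [h|[lt|[-> bc]]]; last by apply: right_slex.
  by inversion h; [left|right].
exact: left_slex.
Qed.

Lemma olt_osucc a : olt a (osucc a).
Proof.
exists Some, None; split=> // -[z|]; split=> //; first by exists z.
by case.
Qed.

Lemma osucc_pos a : ~ is_zero (osucc a).
Proof. by move/(_ None). Qed.

Lemma odouble_pos a : ~ is_zero a -> ~ is_zero (odouble a).
Proof. by move=> a0 z; apply: a0 => x; apply: z (x, false). Qed.

(** Descending from [m] to [h] leaves room for two quantifier blocks: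
    2h + 1 < 2m.  This is where the factor 2 in the complexity comes from. *)
Lemma olt_osucc_double (a : wellorder) (h m : a) :
  wo_lt h m -> olt (osucc (odouble (seg h))) (odouble (seg m)).
Proof.
move=> hm; pose top : seg m := exist _ h hm.
pose up (x : seg h) : seg m := exist _ (sval x) (wo_trans (svalP x) hm).
exists (fun x : osucc (odouble (seg h)) =>
          if x is Some (y, b) then (up y, b) else (top, false)), (top, true).
have up_inj x y : up x = up y -> x = y by move=> [e]; apply: seg_ext.
have ltup x : wo_lt (up x) top by exact: svalP x.
split=> [[[x b]|] [[y c]|]|[[z zm] c]] /=.
- rewrite (@double_ltE (seg h)) (@double_ltE (seg m)); split=> [] [lt|[e bc]]; [by left| |by left|].
    by right; rewrite e.
  by right; split=> //; apply: up_inj.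
- rewrite (@double_ltE (seg m)); split=> // _; left; exact: ltup.
- rewrite (@double_ltE (seg m)); split=> // -[lt|[e _]].
    exact: wo_irrefl (wo_trans lt (ltup y)).
  by apply: (@wo_irrefl (seg m) top); rewrite {1}e; apply: ltup.
- by rewrite (@double_ltE (seg m)) andbF; split=> // -[|[]] //; apply: wo_irrefl.
- rewrite (@double_ltE (seg m)); split=> [[lt|[e]]|[[[y b]|] e]].
  + by exists (Some (exist _ z lt, c)); congr pair; apply: seg_ext.
  + by rewrite andbT => /negbTE ->; exists None; rewrite e.
  + by left; have /= <- := congr1 fst e; apply: ltup.
  + by right; have /= <- := congr1 fst e; have /= <- := congr1 snd e.
Qed.

(** The ordinals up to and including [a] are the initial segments of [osucc a],
    and their doubles are at most 2a. *)
Lemma olt_double_osucc (a : wellorder) (m : osucc a) :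
  olt (odouble (seg m)) (osucc (odouble a)).
Proof.
have some (x : seg m) : exists y : a, Some y = sval x.
  by case: x => -[y|] //= lt; exists y.
have [g gE] := choice _ some.
have gmono x y : wo_lt x y <-> wo_lt (g x) (g y).
  by rewrite /= /seg_lt -!gE.
have ginj x y : g x = g y -> x = y by move=> e; apply: seg_ext; rewrite -!gE e.
have mono (x y : odouble (seg m)) : wo_lt x y <-> wo_lt (Some (g x.1, x.2) : osucc (odouble a)) (Some (g y.1, y.2)).
  case: x y => [x b] [y c]; rewrite /= !double_ltE gmono.
  by split=> [] [lt|[e bc]]; [by left|right; rewrite e|by left|right; split=> //; apply: ginj].
pose bound : osucc (odouble a) := if m is Some y then Some (y, false) else None.
have below z : wo_lt z bound <-> if z is Some y then wo_lt (Some y.1 : osucc a) m else False.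
  case: z => [[z c]|]; rewrite /bound; case: (m) => [y|] //=.
  by rewrite double_ltE andbF; split=> [[|[]] //|]; left.
exists (fun x : odouble (seg m) => Some (g x.1, x.2)), bound; split=> // z.
rewrite below; split=> [|[[x b] <-] /=]; last by have := svalP x; rewrite -gE.
case: z => [[z c] zm|//]; exists (exist _ (Some z) zm, c); congr (Some (_, _)).
by have := gE (exist _ (Some z) zm) => -[].
Qed.

(** The new top element is numbered 0 and the other numbers are shifted. *)
Lemma computable_osucc a : computable_ordinal a -> computable_ordinal (osucc a).
Proof.
move=> [num [inj [d cd dE] [r cr rE]]].
exists (fun x : osucc a => if x is Some y then (num y).+1 else 0); split.
- by move=> [x|] [y|] //= [] /inj ->.
- exists (fun n => if n is m.+1 then d m else 1).
    apply: (comp_case (g := fun _ m => d m)); computable.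
    by apply: (comp_comp cd); computable.
  move=> [|n]; first by split=> // _; exists None.
  rewrite -dE; split=> [[[x|] //= [<-]]|[x <-]]; first by exists x.
  by exists (Some x).
exists (fun z => if lft z is m.+1 then (if rgt z is n.+1 then r (pairn m n) else d m) else 0).
  apply: (comp_case (g := fun z m => if rgt z is n.+1 then r (pairn m n) else d m)); computable.
  apply: (comp_case (n := fun z => rgt (lft z)) (g := fun z n => r (pairn (rgt z) n)));
    computable; first by apply: (comp_comp cd); computable.
  by apply: (comp_comp cr); computable.
move=> z; split=> [[[x|] [[y|] [//= lt ->]]]|].
- by rewrite !pairE; apply/rE; exists x, y.
- by rewrite !pairE; apply/dE; exists x.
rewrite -{3}(pairn_eta z); case: (lft z) (rgt z) => [|m] [|n] //.
  by move/dE => [x <-]; exists (Some x), None.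
by move/rE => [x [y [lt /pairn_inj [-> ->]]]]; exists (Some x), (Some y).
Qed.

(** * Back-and-forth relations along initial segments *)

Lemma bf_seg0 L (at_ : atomic_listing L) (a : wellorder) (m : a) (C D : structure L)
    (x : seq C) (y : seq D) :
  is_zero (seg m) -> bf at_ (seg m) x y <-> bf_zero at_ x y.
Proof. by move=> m0; split=> [[]|] //; apply: bf_base. Qed.

Lemma bf_segS L (at_ : atomic_listing L) (a : wellorder) (m : a) (C D : structure L)
    (x : seq C) (y : seq D) :
  ~ is_zero (seg m) ->
  bf at_ (seg m) x y <->
  forall h, wo_lt h m -> forall d : seq D,
    exists c : seq C, size c = size d /\ bf at_ (seg h) (y ++ d) (x ++ c).
Proof.
move=> m0; split=> [[] // _ H h hm d|H]; first by apply: H; apply: seg_olt.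
apply: bf_step => // d g /olt_seg [h hm gh]; have [c [e bfc]] := H h hm d.
by exists c; split=> //; apply: bf_iso (iso_sym gh) bfc.
Qed.

Lemma bf_seg_refl L (at_ : atomic_listing L) (a : wellorder) (m : a) (C : structure L)
    (x : seq C) : bf at_ (seg m) x x.
Proof.
elim: (wo_wf m) x => {}m _ IH x.
case: (classic (is_zero (seg m))) => m0; first by apply/bf_seg0.
by apply/bf_segS => // h hm d; exists d; split=> //; apply: IH.
Qed.

(** * The relation at ordinal zero *)

Lemma term_val_ext L (C : structure L) (v w : nat -> C) (t : term L) :
  (forall j, term_var t j -> v j = w j) -> term_val v t = term_val w t.
Proof.
elim: t => [i|f ts IH] /= vw; first exact: vw.
congr fun_int; apply: functional_extensionality => i; apply: IH => j ij.
by apply: vw; exists i.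
Qed.

Lemma atomic_sat_ext L (C : structure L) (v w : nat -> C) (p : atomic L) :
  (forall j, atomic_var p j -> v j = w j) -> atomic_sat v p <-> atomic_sat w p.
Proof.
case: p => [s t|r ts] /= vw.
  by rewrite !(@term_val_ext _ _ v w) // => j ?; apply: vw; [right|left].
suff -> : (fun i => term_val v (ts i)) = (fun i => term_val w (ts i)) by [].
apply: functional_extensionality => i; apply: term_val_ext => j ij.
by apply: vw; exists i.
Qed.

Definition atom_code L (n y : nat) : Prop :=
  exists2 p : atomic L, gn_atomic p = y & forall j, atomic_var p j -> j < n.

(** The following lists are meant for languages all of whose symbols have index
    below [N], with no function symbols but constants.  A constant carries the
    empty list of arguments, whose code is 0. *)
Definition const_codes L (N : nat) : seq nat :=
  [seq pairn 1 (pairn f 0) | f <- iota 0 N & isSome (fun_ar L f)].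

Definition term_codes L (N n : nat) : seq nat :=
  [seq pairn 0 i | i <- iota 0 n] ++ const_codes L N.

Fixpoint tuple_codes (a : nat) (T : seq nat) : seq nat :=
  if a is a'.+1 then [seq (pairn t c).+1 | t <- T, c <- tuple_codes a' T] else [:: 0].

Definition atomic_codes L (N n : nat) : seq nat :=
  let T := term_codes L N n in
  [seq pairn 0 (pairn s t) | s <- T, t <- T] ++
  flatten [seq [seq pairn 1 (pairn r c) | c <- tuple_codes (odflt 0 (rel_ar L r)) T]
          | r <- iota 0 N & isSome (rel_ar L r)].

Lemma lcomp_atomic_codes L N : lcomp (atomic_codes L N).
Proof.
have cT : lcomp (term_codes L N).
  apply: lcomp_cat; last exact: lcomp_const.
  by apply: (lcomp_map (g := fun _ i => pairn 0 i)); [apply: lcomp_iota|]; computable.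
apply: lcomp_cat.
  by apply: (lcomp_allpairs (f := fun s t => pairn 0 (pairn s t))) => //; computable.
elim: [seq r <- iota 0 N | _] => [|r rs IH] /=; first exact: lcomp_const.
apply: lcomp_cat IH; apply: (lcomp_map (g := fun _ c => pairn 1 (pairn r c))); computable.
elim: (odflt _ _) => [|a IH] /=; first exact: lcomp_const.
by apply: (lcomp_allpairs (f := fun t c => (pairn t c).+1)) => //; computable.
Qed.

Lemma tuple_codesP a T c :
  reflect (exists s, [/\ c = code_seq s, size s = a & {subset s <= T}])
          (c \in tuple_codes a T).
Proof.
elim: a c => [|a IH] c /=.
  rewrite inE; apply: (iffP eqP) => [->|[s [-> /size0nil -> _]]] //.
  by exists [::].
apply: (iffP allpairsP) => [[[t d] /= [tT /IH [s [-> sz sT]] ->]]|[[|t s] [//= -> [sz] sT]]].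
  by exists (t :: s); split=> //=; rewrite ?sz // => z /[!inE] /predU1P [->|/sT].
exists (t, code_seq s); split=> //=; first by apply: sT; rewrite mem_head.
by apply/IH; exists s; split=> // z zs; apply: sT; rewrite inE zs orbT.
Qed.

Lemma map_nth_enum_ord (s : seq nat) n :
  size s = n -> [seq nth 0 s (i : 'I_n) | i <- enum 'I_n] = s.
Proof.
move=> sz; rewrite -[RHS](mkseq_nth 0) /mkseq sz -val_enum_ord -map_comp.
exact: eq_map.
Qed.

Lemma term_codesP L N n t :
  (forall k, isSome (rel_ar L k) || isSome (fun_ar L k) -> k < N) ->
  (forall f : Defs.fsym L, farity f = 0) ->
  t \in term_codes L N n <->
  exists2 s : term L, gn_term s = t & forall j, term_var s j -> j < n.
Proof.
move=> bN ar0.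
have nov (f : Defs.fsym L) (i : 'I_(farity f)) : False.
  by case: i => i; rewrite ar0.
have noE (f : Defs.fsym L) : enum 'I_(farity f) = [::].
  by apply: size0nil; rewrite size_enum_ord ar0.
rewrite mem_cat; split.
  move=> /orP [/mapP [i]|/mapP [f]].
    by rewrite mem_iota add0n => lt ->; exists (Var i) => // j /= <-.
  rewrite mem_filter => /andP [hf _] ->.
  exists (App (f := exist _ f hf) (fun _ => Var 0)); last by move=> j [/nov].
  by rewrite /= noE.
case=> [[i|f ts]] <- vars /=; apply/orP; [left|right].
  by rewrite map_f // mem_iota add0n; apply: vars.
rewrite noE /=; apply: map_f; rewrite mem_filter mem_iota add0n.
by have h := valP f; rewrite h bN //= h orbT.
Qed.

Lemma atomic_codesP L N n y :
  (forall k, isSome (rel_ar L k) || isSome (fun_ar L k) -> k < N) ->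
  (forall f : Defs.fsym L, farity f = 0) ->
  y \in atomic_codes L N n <-> atom_code L n y.
Proof.
move=> bN ar0; have tP t := @term_codesP L N n t bN ar0.
rewrite mem_cat; split=> [/orP [|]|].
- move=> /allpairsP [[c d] /= [/tP [s <- sv] /tP [t <- tv] ->]].
  by exists (Eq s t) => // j [/sv|/tv].
- move=> /flatten_mapP [r]; rewrite mem_filter => /andP [hr _].
  move=> /mapP [c /tuple_codesP [s [-> sz sT]] ->].
  pose r' : rsym L := exist _ r hr.
  have [ts tsP] : exists ts : 'I_(rarity r') -> term L, forall i,
      gn_term (ts i) = nth 0 s i /\ forall j, term_var (ts i) j -> j < n.
    apply: (choice (fun (i : 'I_(rarity r')) (t : term L) =>
      gn_term t = nth 0 s i /\ forall j, term_var t j -> j < n)) => i.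
    have /sT/tP [t et vt] : nth 0 s i \in s by rewrite mem_nth // sz; apply: (valP i).
    by exists t.
  exists (Rel (r := r') ts) => /=; last by move=> j [i]; apply: (tsP i).2.
  rewrite -[in RHS](map_nth_enum_ord sz).
  by congr (pairn _ (pairn _ (code_seq _))); apply: eq_map => i; rewrite (tsP i).1.
case=> [[s t|r ts]] <- vars; apply/orP; [left|right].
  by apply/allpairsP; exists (gn_term s, gn_term t); split=> //=; apply/tP;
     [exists s|exists t] => // j h; apply: vars; [left|right].
have hr := valP r; apply/flatten_mapP; exists (val r).
  by rewrite mem_filter mem_iota add0n hr bN //= hr.
apply: map_f; apply/tuple_codesP; eexists; split; first by [].
  by rewrite size_map size_enum_ord.
move=> _ /mapP [i _ ->]; apply/tP; exists (ts i) => // j ij.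
by apply: vars; exists i.
Qed.

(** In a finite language the list consists of all atomic formulas in that many
    variables, which can be generated because terms are variables or one of
    finitely many constants.  In an infinite language it is an initial part of the
    given listing. *)
Lemma effective_bf_zero L (at_ : atomic_listing L) :
  exists F : nat -> seq nat,
    [/\ lcomp F, forall n y, y \in F n -> atom_code L n y
      & forall (C D : structure L) (x : seq C) (y : seq D),
          bf_zero at_ x y <->
          forall p : atomic L, gn_atomic p \in F (size x) ->
            (atomic_sat (tuple_env x) p <-> atomic_sat (tuple_env y) p)].
Proof.
case: (classic (finite_language L)) => fin.
  have [[N bN] ar0] := fin; have acP := @atomic_codesP L N _ _ bN ar0.
  exists (atomic_codes L N); split=> [|n y|C D x y]; first exact: lcomp_atomic_codes.
    by move/acP.
  split=> [[/(_ fin) h _] p /acP [q /gn_atomic_inj <-]|h]; first exact: h.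
  by split=> // _ p vars; apply: h; apply/acP; exists p.
exists (fun n => [seq gn_atomic (at_ i) | i <- iota 0 n]); split.
- apply: (lcomp_map (g := fun _ i => gn_atomic (at_ i))).
    by apply: lcomp_iota; computable.
  by apply: (comp_comp (list_effective at_)); computable.
- move=> n y /mapP [i]; rewrite mem_iota add0n => lt ->.
  by exists (at_ i) => // j /list_var le; apply: leq_ltn_trans le lt.
- move=> C D x y; split=> [[_ /(_ fin) h] p /mapP [i]|h].
    by rewrite mem_iota add0n => lt /gn_atomic_inj ->; apply: h.
  by split=> // _ i lt; apply: h; apply/mapP; exists i; rewrite ?mem_iota.
Qed.

Definition literal_code (f : nat -> nat) (b y : nat) : nat :=
  if f (pairn y b) == 1 then pairn 2 (pairn 1 y) else pairn 1 y.

Definition differ_code (f : nat -> nat) (b : nat) (s : seq nat) : nat :=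
  foldr (fun y r => pairn 4 (pairn (literal_code f b y) r)) (pairn 2 (pairn 0 0)) s.

Lemma comp_differ_code f b s :
  computable f -> computable b -> lcomp s ->
  computable (fun x => differ_code f (b x) (s x)).
Proof.
move=> cf cb cs.
apply: (comp_foldr (h := fun x y r => pairn 4 (pairn (literal_code f (b x) y) r))) => //;
  computable.
apply: (comp_if (t := fun z => f (pairn (lft (rgt z)) (b (lft z))) == 1)); computable.
apply: comp_eq; last by computable.
by apply: (comp_comp cf); computable; apply: (comp_comp cb); computable.
Qed.

(** A disjunction over the list [s]: the disjunct of an atomic formula is its
    negation if the atomic diagram contains it for [b], and the formula itself
    otherwise. *)
Lemma differ_formula L (B : structure L) f (b : seq B) (s : seq nat) :
  (forall n, atomic_diagram B n <-> f n = 1) ->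
  (forall y, y \in s -> atom_code L (size b) y) ->
  exists q : qf L,
    [/\ gn_qf q = differ_code f (code_seq [seq val x | x <- b]) s,
        forall j, qf_var q j -> j < size b
      & forall (C : structure L) (v : nat -> C), qf_sat v q <->
          ~ forall p : atomic L, gn_atomic p \in s ->
              (atomic_sat (tuple_env b) p <-> atomic_sat v p)].
Proof.
move=> fE; elim: s => [|y s IH] sP.
  by exists (QNot (@QTrue L)); split=> // C v /=; split=> // h; case: h.
have [|q [qn qv qs]] := IH; first by move=> z zs; apply: sP; rewrite inE zs orbT.
have [p py pv] := sP y (mem_head _ _).
have diag : f (pairn y (code_seq [seq val x | x <- b])) = 1 <->
            atomic_sat (tuple_env b) p.
  rewrite -fE; split=> [[p' [b' []]]|pb]; last by exists p, b; rewrite py.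
  rewrite -py => /pairn_inj [/gn_atomic_inj <- /code_seq_inj e] _.
  by rewrite (inj_map val_inj e).
pose l := if f (pairn y (code_seq [seq val x | x <- b])) == 1 then QNot (QAtom p) else QAtom p.
exists (QOr l q); split.
- rewrite [LHS]/= qn /= /literal_code /l.
  by case: eqP => _ /=; rewrite py.
- by move=> j [|/qv //]; rewrite /l; case: eqP => _ /pv.
- move=> C v /=; rewrite qs.
  have lE : qf_sat v l <-> ~ (atomic_sat (tuple_env b) p <-> atomic_sat v p).
    by rewrite /l -diag; case: eqP => /= e; tauto.
  rewrite lE; split=> [[h|h] H|H].
  + by apply: h; apply: H; rewrite py mem_head.
  + by apply: h => p' ps; apply: H; rewrite inE ps orbT.
  + apply: not_and_or => -[h1 h2]; apply: H => p'.
    by rewrite inE => /predU1P [|]; [rewrite -py => /gn_atomic_inj ->|apply: h2].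
Qed.

(** * Formulas defining the back-and-forth relations *)

Lemma mkseq_split T (v w : nat -> T) n k :
  (forall j, j \notin iota n k -> w j = v j) ->
  mkseq w (n + k) = mkseq v n ++ mkseq (fun i => w (n + i)) k.
Proof.
move=> wv; rewrite /mkseq iotaD map_cat add0n; congr cat; last first.
  by rewrite -[in LHS](addn0 n) iotaDl -map_comp.
apply/eq_in_map => j; rewrite mem_iota => /andP [_ lt]; apply: wv.
by rewrite mem_iota leqNgt lt.
Qed.

Lemma extend_env T (x0 : T) (v : nat -> T) n (c : seq T) :
  exists w, (forall j, j \notin iota n (size c) -> w j = v j) /\
            mkseq w (n + size c) = mkseq v n ++ c.
Proof.
pose w j := if j \in iota n (size c) then nth x0 c (j - n) else v j.
have wv j : j \notin iota n (size c) -> w j = v j by rewrite /w => /negbTE ->.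
exists w; split=> //; rewrite (mkseq_split wv); congr cat.
rewrite -[RHS](mkseq_nth x0); apply/eq_in_map => i; rewrite mem_iota => /andP [_ lt].
by rewrite /w mem_iota leq_addr ltn_add2l lt addKn.
Qed.

Lemma all_domP L (B : structure L) (s : seq nat) :
  reflect (exists x : seq B, s = [seq val y | y <- x]) (all (dom B) s).
Proof.
apply: (iffP idP) => [|[x ->]]; last first.
  by apply/allP => _ /mapP [y _ ->]; apply: (valP y).
elim: s => [|a s IH] /=; first by exists [::].
by move=> /andP [ha /IH [x ->]]; exists (exist _ a ha :: x).
Qed.

Lemma not_bf_segS L (at_ : atomic_listing L) (a : wellorder) (m : a) (C D : structure L)
    (x : seq C) (y : seq D) :
  ~ is_zero (seg m) ->
  ~ bf at_ (seg m) x y <->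
  exists h (d : seq D), wo_lt h m /\
    forall c : seq C, size c = size d -> ~ bf at_ (seg h) (y ++ d) (x ++ c).
Proof.
move=> m0; rewrite (bf_segS at_ x y m0); split=> [H|[h [d [hm H]]] /(_ h hm d) [c [e]]].
  apply: NNPP => N; apply: H => h hm d; apply: NNPP => M; apply: N.
  by exists h, d; split=> // c e bfc; apply: M; exists c.
exact: H.
Qed.

(** A program recognises the code of zero by comparison with the constant [z],
    because at most one element of a well-order has nothing below it. *)
Lemma zero_code (a : wellorder) (num : a -> nat) :
  injective num -> exists z, forall m : a, num m = z <-> is_zero (seg m).
Proof.
move=> inj; case: (classic (exists m : a, is_zero (seg m))) => [[m m0]|none].
  exists (num m) => h; split=> [/inj -> //|h0]; congr num.
  by case: (wo_total h m) => // lt; [case: (m0 (exist _ h lt)) | case: (h0 (exist _ m lt))].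
exists 0 => m; exfalso; elim: (wo_wf m) => {}m _ IH.
by apply: none; exists m; apply/is_zero_seg.
Qed.

(** The direction [pol] alternates in the recursion.  The first structure is the
    one whose elements the formulas mention through their indices, the second
    the one in which they are evaluated. *)
Definition bf_dir L (at_ : atomic_listing L) (pol : bool) (a : wellorder) (m : a)
    (B C : structure L) (x : seq B) (y : seq C) : Prop :=
  if pol then bf at_ (seg m) x y else bf at_ (seg m) y x.

Lemma bf_dir0 L (at_ : atomic_listing L) (F : nat -> seq nat) pol (a : wellorder) (m : a)
    (B C : structure L) (x : seq B) (v : nat -> C) :
  (forall n y, y \in F n -> atom_code L n y) ->
  (forall (C D : structure L) (x : seq C) (y : seq D),
     bf_zero at_ x y <-> forall p : atomic L, gn_atomic p \in F (size x) ->
            (atomic_sat (tuple_env x) p <-> atomic_sat (tuple_env y) p)) ->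
  is_zero (seg m) ->
  bf_dir at_ pol m x (mkseq v (size x)) <->
  forall p : atomic L, gn_atomic p \in F (size x) ->
    (atomic_sat (tuple_env x) p <-> atomic_sat v p).
Proof.
move=> Fvar FP m0.
have env p : gn_atomic p \in F (size x) ->
    atomic_sat (tuple_env (mkseq v (size x))) p <-> atomic_sat v p.
  move=> /Fvar [q /gn_atomic_inj -> pv]; apply: atomic_sat_ext => j /pv lt.
  by rewrite /tuple_env nth_mkseq.
rewrite /bf_dir; case: pol; rewrite bf_seg0 // FP ?size_mkseq.
  by split=> h p hp; have := env p hp; have := h p hp; tauto.
by split=> h p hp; have := env p hp; have := h p hp; tauto.
Qed.

(** The state of a formula: its connective, its direction [pol], the code [g] of
    an ordinal, the code [b] of the tuple reached so far, and the code [d] of a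
    tuple just chosen, which only conjunctions carry. *)
Definition state (conj pol : bool) (g b d : nat) : nat :=
  pairn conj (pairn pol (pairn g (pairn b d))).

Definition st_conj (s : nat) : bool := lft s == 1.
Definition st_pol (s : nat) : bool := lft (rgt s) == 1.
Definition st_ord (s : nat) : nat := lft (rgt (rgt s)).
Definition st_tup (s : nat) : seq nat := dec (lft (rgt (rgt (rgt s)))).
Definition st_new (s : nat) : seq nat := dec (rgt (rgt (rgt (rgt s)))).

Lemma stateE conj pol g b d :
  let s := state conj pol g (code_seq b) (code_seq d) in
  (st_conj s = conj) * (st_pol s = pol) * (st_ord s = g) * (st_tup s = b) * (st_new s = d).
Proof.
rewrite /= /st_conj /st_pol /st_ord /st_tup /st_new /state !pairE !code_seqK.
by case: conj; case: pol.
Qed.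

Lemma comp_state (conj pol : nat -> bool) g b d :
  computable (fun x => conj x : nat) -> computable (fun x => pol x : nat) ->
  computable g -> computable b -> computable d ->
  computable (fun x => state (conj x) (pol x) (g x) (b x) (d x)).
Proof. by move=> *; rewrite /state; computable. Qed.

Lemma comp_st_conj f : computable f -> computable (fun x => st_conj (f x) : nat).
Proof. by move=> cf; apply: comp_eq; computable. Qed.

Lemma comp_st_pol f : computable f -> computable (fun x => st_pol (f x) : nat).
Proof. by move=> cf; apply: comp_eq; computable. Qed.

Lemma comp_st_ord f : computable f -> computable (fun x => st_ord (f x)).
Proof. by move=> cf; rewrite /st_ord; computable. Qed.

Lemma comp_st_tup f : computable f -> lcomp (fun x => st_tup (f x)).
Proof. by move=> cf; apply: lcomp_dec; computable. Qed.

Lemma comp_st_new f : computable f -> lcomp (fun x => st_new (f x)).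
Proof. by move=> cf; apply: lcomp_dec; computable. Qed.

Lemma comp_neg (t : nat -> bool) :
  computable (fun x => t x : nat) -> computable (fun x => ~~ t x : nat).
Proof.
move=> ct; apply: (comp_ext (f := fun x => if t x then 0 else 1)).
  by move=> x; case: (t x).
by apply: comp_if; computable.
Qed.

Lemma lcomp_if (t : nat -> bool) F G :
  computable (fun x => t x : nat) -> lcomp F -> lcomp G ->
  lcomp (fun x => if t x then F x else G x).
Proof.
move=> ct cF cG; apply: (comp_ext (f := fun x => if t x then code_seq (F x) else code_seq (G x))).
  by move=> x; case: (t x).
exact: comp_if.
Qed.

(** The system of formulas expressing failure of the back-and-forth relations.
    A disjunctive state chooses a smaller ordinal and a tuple in the structure
    on the right, a conjunctive state ranges over the answers to it of the
    same length.  A tuple of [B] is chosen by the index of the connective, and a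
    tuple of the other structure by quantified new variables.  In the latter case
    the index still contains a tuple of [B], of which only the length matters. *)
Definition bf_guard (D : pred nat) (r : nat -> nat) (s x : nat) : bool :=
  if st_conj s then all D (dec x) && (size (dec x) == size (st_new s))
  else (r (pairn (lft x) (st_ord s)) == 1) && all D (dec (rgt x)).

Definition bf_vars (s x : nat) : seq nat :=
  if st_conj s then
    if st_pol s then [::] else iota (size (st_tup s)) (size (st_new s))
  else
    if st_pol s then iota (size (st_tup s)) (size (dec (rgt x))) else [::].

Definition bf_next (s x : nat) : nat :=
  if st_conj s then
    state false (~~ st_pol s) (st_ord s)
      (code_seq (st_tup s ++ if st_pol s then dec x else st_new s)) (code_seq [::])
  else
    state true (st_pol s) (lft x) (code_seq (st_tup s)) (rgt x).

Lemma comp_bf_guard (D : pred nat) (r : nat -> nat) :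
  computable (fun n => D n : nat) -> computable r ->
  computable (fun z => bf_guard D r (lft z) (rgt z) : nat).
Proof.
move=> cD cr; rewrite /bf_guard.
apply: (comp_ext (f := fun z => if st_conj (lft z)
  then (all D (dec (rgt z)) && (size (dec (rgt z)) == size (st_new (lft z))) : nat)
  else ((r (pairn (lft (rgt z)) (st_ord (lft z))) == 1) && all D (dec (rgt (rgt z))) : nat))).
  by move=> z; case: (st_conj _).
apply: comp_if; first by apply: comp_st_conj; computable.
  apply: comp_and; first by apply: comp_all => //; apply: lcomp_dec; computable.
  apply: comp_eq; apply: comp_size; first by apply: lcomp_dec; computable.
  by apply: comp_st_new; computable.
apply: comp_and; last by apply: comp_all => //; apply: lcomp_dec; computable.
apply: comp_eq; last by computable.
by apply: (comp_comp cr); computable.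
Qed.

Lemma comp_bf_vars : lcomp (fun z => bf_vars (lft z) (rgt z)).
Proof.
apply: lcomp_if; first by apply: comp_st_conj; computable.
  apply: lcomp_if; first by apply: comp_st_pol; computable.
    exact: lcomp_const.
  by apply: lcomp_iota; apply: comp_size; [apply: comp_st_tup|apply: comp_st_new]; computable.
apply: lcomp_if; first by apply: comp_st_pol; computable.
  by apply: lcomp_iota; apply: comp_size; [apply: comp_st_tup|apply: lcomp_dec]; computable.
exact: lcomp_const.
Qed.

Lemma comp_bf_next : computable (fun z => bf_next (lft z) (rgt z)).
Proof.
apply: comp_if; first by apply: comp_st_conj; computable.
  apply: (comp_state (conj := xpred0) (pol := fun z => ~~ st_pol (lft z))).
  - exact: comp_const.
  - by apply: comp_neg; apply: comp_st_pol; computable.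
  - by apply: comp_st_ord; computable.
  - apply: lcomp_cat; first by apply: comp_st_tup; computable.
    apply: lcomp_if; first by apply: comp_st_pol; computable.
      by apply: lcomp_dec; computable.
    by apply: comp_st_new; computable.
  - exact: comp_const.
apply: (comp_state (conj := xpredT) (pol := fun z => st_pol (lft z))); computable.
  by apply: comp_st_pol; computable.
by apply: comp_st_tup; computable.
Qed.

(** By induction on [m], for both directions at once.  A disjunctive state leads
    to the conjunctive states that follow the choice of [h] below [m] and of a
    tuple; these have complexity 2h + 1, and lead back to disjunctive states of
    complexity 2h. *)
Theorem bf_indices L (at_ : atomic_listing L) (a : wellorder) (B : structure L) :
  computable_ordinal a -> computable_structure B ->
  exists idx : bool -> a -> seq B -> nat, forall pol m x,
    denotes (idx pol m x) (Sigma_in (odouble (seg m))) (size x)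
      (fun (C : structure L) v => ~ bf_dir at_ pol m x (mkseq v (size x))).
Proof.
move=> [num [num_inj _ [r cr rE]]] [[dm cdm dmE] [f cf fE]].
have cD : computable (fun n => dom B n : nat).
  apply: (comp_ext (f := fun n => dm n == 1)); last by apply: comp_eq; computable.
  move=> n; congr nat_of_bool; apply/eqP/idP => /dmE //.
have [z zE] := zero_code num_inj.
have [F [cF Fvar FP]] := effective_bf_zero at_.
have [idx [e [idxE eE]]] := @index_scheme
  (fun s => ~~ st_conj s && (st_ord s == z)) (fun s => if st_conj s then 2 else 1)
  (fun s => differ_code f (code_seq (st_tup s)) (F (size (st_tup s))))
  (bf_guard (dom B) r) bf_next (fun s x => code_seq (bf_vars s x))
  (comp_and (comp_neg (comp_st_conj comp_id)) (comp_eq (comp_st_ord comp_id) (comp_const z)))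
  (comp_if (comp_st_conj comp_id) (comp_const 2) (comp_const 1))
  (comp_differ_code cf (comp_st_tup comp_id) (lcomp_comp cF (comp_size (comp_st_tup comp_id))))
  (comp_bf_guard cD cr) comp_bf_next comp_bf_vars.
have idx_conj s : st_conj s = true -> idx s = pairn 2 (gn_prog (e s)).
  by rewrite idxE => ->.
have idx_disj s : st_conj s = false -> idx s =
    if st_ord s == z then
      pairn 0 (differ_code f (code_seq (st_tup s)) (F (size (st_tup s))))
    else pairn 1 (gn_prog (e s)).
  by rewrite idxE => ->.
pose vals (x : seq B) := [seq val y | y <- x].
have vals_inj : injective vals by apply: inj_map; apply: val_inj.
have vals_dom x : all (dom B) (vals x) by apply/all_domP; exists x.
have sz_vals x : size (vals x) = size x by rewrite size_map.
pose s0 pol m x := state false pol (num m) (code_seq (vals x)) (code_seq [::]).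
exists (fun pol m x => idx (s0 pol m x)) => pol m.
elim: (wo_wf m) pol => {}m _ IH pol x.
case: (classic (is_zero (seg m))) => m0.
  rewrite idx_disj /s0 !stateE // (introT eqP ((zE m).2 m0)).
  have [|q [qn qv qs]] := @differ_formula L B f x (F (size x)) fE; first exact: Fvar.
  rewrite sz_vals -qn.
  apply: (denotes_ext (S := fun C v => qf_sat v q)).
    by move=> C v; rewrite qs (@bf_dir0 L at_ F pol a m B C x v Fvar FP m0).
  apply: denotes_qf qv => -[y _]; exact: m0 y.
(* the meaning of the conjunctive state after the choice of [h] and of [d] *)
pose S (h : a) (d : seq B) (C : structure L) (v : nat -> C) :=
  if pol then forall d' : seq B, size d' = size d ->
    ~ bf_dir at_ false h (x ++ d') (mkseq v (size x + size d))
  else forall c : seq C, size c = size d ->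
    ~ bf_dir at_ true h (x ++ d) (mkseq v (size x) ++ c).
pose s1 h d := state true pol (num h) (code_seq (vals x)) (code_seq (vals d)).
have den1 h d : wo_lt h m ->
    denotes (idx (s1 h d)) (Pi_in (osucc (odouble (seg h))))
      (size x + if pol then size d else 0) (S h d).
  move=> hm; rewrite idx_conj; last by rewrite /s1 !stateE.
  pose T y (C : structure L) (v : nat -> C) := forall d' : seq B, dec y = vals d' ->
    ~ bf_dir at_ (~~ pol) h (x ++ if pol then d' else d) (mkseq v (size x + size d)).
  apply: (denotes_ext (S := fun C v => forall y w, bf_guard (dom B) r (s1 h d) y ->
      (forall j, j \notin bf_vars (s1 h d) y -> w j = v j) -> T y C w)).
    move=> C v; rewrite /T /S /bf_guard /bf_vars /s1 !stateE !sz_vals.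
    case: (pol); split=> H.
    - move=> d' e'; apply: (H (code_seq (vals d')) v) => //; last by rewrite code_seqK.
      by rewrite code_seqK vals_dom sz_vals e' eqxx.
    - move=> y w /andP [_ /eqP sz] wv d' e'; rewrite e' sz_vals in sz.
      by rewrite (eq_mkseq (fun j => wv j isT)); apply: H.
    - move=> c e'; have [w [wv we]] := extend_env (point C : C) v (size x) c.
      rewrite -we e'; apply: (H (code_seq (vals d)) w) (d) _.
      + by rewrite code_seqK vals_dom sz_vals eqxx.
      + by move=> j; rewrite -e'; apply: wv.
      + by rewrite code_seqK.
    - move=> y w _ wv d' _; rewrite (mkseq_split wv); apply: H.
      by rewrite size_mkseq.
  apply: (denotes_conj (K := fun=> size x + size d)); first exact: osucc_pos.
  - exact: eE.
  - move=> y; rewrite /bf_guard /bf_next /T /s1 !stateE => /andP [/all_domP [d' yd] /eqP sz].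
    exists (odouble (seg h)); split; first exact: olt_osucc.
    rewrite yd !sz_vals in sz.
    have := IH h hm (~~ pol) (x ++ if pol then d' else d).
    have -> : size (x ++ if pol then d' else d) = size x + size d.
      by rewrite size_cat; case: (pol); rewrite ?sz.
    have -> : s0 (~~ pol) h (x ++ if pol then d' else d) =
        state false (~~ pol) (num h) (code_seq (vals x ++ if pol then dec y else vals d))
          (code_seq [::]).
      by rewrite /s0 /vals map_cat yd; case: (pol).
    apply: denotes_ext => C v; split=> [H d''|H]; last exact: H.
    by rewrite yd => /vals_inj <-.
  - move=> y j _; rewrite /bf_vars /s1 !stateE !sz_vals; case: (pol) => //.
    by rewrite mem_iota addn0; lia.
rewrite idx_disj {1}/s0 !stateE //; case: eqP => [/zE //|_].
pose T y (C : structure L) (v : nat -> C) := forall h (d : seq B), lft y = num h -> dec (rgt y) = vals d ->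
  S h d C v.
have guardE y : bf_guard (dom B) r (s0 pol m x) y ->
    exists h d, [/\ wo_lt h m, lft y = num h & dec (rgt y) = vals d].
  rewrite /bf_guard /s0 !stateE => /andP [/eqP /rE [h [m' [lt /pairn_inj [yh /num_inj em]]]]].
  by move=> /all_domP [d yd]; exists h, d; rewrite em.
have guardI h d : wo_lt h m -> bf_guard (dom B) r (s0 pol m x) (pairn (num h) (code_seq (vals d))).
  move=> hm; rewrite /bf_guard /s0 !stateE !pairE code_seqK vals_dom andbT.
  by apply/eqP/rE; exists h, m.
have TE h d (C : structure L) (v : nat -> C) : T (pairn (num h) (code_seq (vals d))) C v <-> S h d C v.
  rewrite /T !pairE code_seqK; split=> [H|H h' d' /num_inj <- /vals_inj <- //].
  exact: H.
apply: (denotes_ext (S := fun C v => exists y w, [/\ bf_guard (dom B) r (s0 pol m x) y,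
    forall j, j \notin bf_vars (s0 pol m x) y -> w j = v j & T y C w])).
  move=> C v; rewrite /bf_vars /s0 !stateE !sz_vals -/(s0 pol m x).
  rewrite /bf_dir; split.
    move=> [y [w [/guardE [h [d [hm yh yd]]] + /(_ h d yh yd)]]]; rewrite /S yd sz_vals.
    case: (pol) => wv H; apply/(not_bf_segS at_ _ _ m0).
      exists h, (mkseq (fun i => w (size x + i)) (size d)); split=> // d'.
      by rewrite size_mkseq -(mkseq_split wv); apply: H.
    by exists h, d; split=> // c e'; rewrite -(eq_mkseq (fun j => wv j isT)); apply: H.
  move: TE guardI; rewrite /S; case: (pol) => TE guardI.
    move=> /(not_bf_segS at_ _ _ m0) [h [c [hm H]]].
    have [w [wv we]] := extend_env (point C : C) v (size x) c.
    (* any tuple of [B] of the length of [c] serves as an index *)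
    pose d := nseq (size c) (point B : B).
    exists (pairn (num h) (code_seq (vals d))), w; split; first exact: guardI.
      by move=> j; rewrite !pairE code_seqK sz_vals size_nseq; apply: wv.
    by apply/TE => d'; rewrite size_nseq we; apply: H.
  move=> /(not_bf_segS at_ _ _ m0) [h [d [hm H]]].
  exists (pairn (num h) (code_seq (vals d))), v; split=> //; first exact: guardI.
  by apply/TE.
apply: (denotes_disj (K := fun y => size x + if pol then size (dec (rgt y)) else 0)).
- exact: odouble_pos.
- exact: eE.
- move=> y /guardE [h [d [hm yh yd]]].
  exists (osucc (odouble (seg h))); split; first exact: olt_osucc_double.
  rewrite /bf_next /s0 !stateE yh -(decK (rgt y)) yd code_seqK sz_vals.
  apply: denotes_ext (den1 h d hm) => C v; rewrite /T yh yd.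
  by split=> [H h' d' /num_inj <- /vals_inj <- //|H]; apply: H.
- move=> y j _; rewrite /bf_vars /s0 !stateE !sz_vals; case: (pol) => /=.
    by rewrite mem_iota; lia.
  by rewrite addn0.
Qed.

Theorem theorem4p3 (L : language) (hL : computable_language L)
    (at_ : atomic_listing L) (alpha : wellorder) (halpha : computable_ordinal alpha)
    (A B : structure L) (hA : computable_structure A) (hB : computable_structure B)
    (hAB : ~ bf_le at_ (osucc alpha) A B) :
  exists phi : form L,
    [/\ Pi_c (osucc (odouble alpha)) phi, sentence phi, models A phi & models_not B phi].
Proof.
(* the tuple in [B], with its ordinal, that no tuple of [A] can answer *)
have [d [m fail]] : exists (d : seq B) (m : osucc alpha), forall c : seq A,
    size c = size d -> ~ bf at_ (seg m) d c.
  apply: NNPP => N; apply: hAB; apply: bf_step => [|d g /olt_iso_seg [m gm]].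
    exact: osucc_pos.
  apply: NNPP => M; apply: N; exists d, m => c e bfc; apply: M; exists c.
  by split=> //; apply: bf_iso (iso_sym gm) bfc.
have [idx den] := bf_indices at_ (computable_osucc halpha) hB.
pose u := iota 0 (size d).
have [] := @denotes_conj L (osucc (odouble alpha))
  (PConst (pairn (code_seq u) (idx true m d))) (fun=> True) (fun=> u) (fun=> idx true m d)
  (fun=> size d) 0 (fun=> fun C v => ~ bf_dir at_ true m d (mkseq v (size d))).
- exact: osucc_pos.
- by move=> n; split=> [[x /eval_const ->]|[_ _ ->]]; exists 0 => //; apply/eval_const.
- by move=> _ _; exists (odouble (seg m)); split; [apply: olt_double_osucc|apply: den].
- by move=> _ j _ lt; rewrite mem_iota add0n lt.
move=> [phi ind] /(_ phi ind) [lev closed satE]; exists phi; split.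
- by split=> //; eexists; apply: ind.
- by move=> j /closed.
- by move=> v; apply/satE => _ w _ _; apply: fail; rewrite size_mkseq.
- move=> v /satE H; have [w [wv we]] := extend_env (point B : B) v 0 d.
  by apply: (H 0 w I wv); rewrite -[size d]add0n we; apply: bf_seg_refl.
Qed.
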